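(* Let $\Gamma$ be a finite loose tree. Let $1<d_1<d_2<\dots<d_k$ be the distinct degrees greater than $1$ occurring among the vertices of $\Gamma$ ($k=0$ allowed), let $n_i$ be the number of vertices of $\Gamma$ of degree $d_i$ $(1\le i\le k)$, let $I=\sum_{i=1}^k n_i-1$, and let $E$ be the number of vertices of $\Gamma$ of degree $1$. Then the class $[\Gamma]_{\mathbb F_1}$ of $\mathcal F(\Gamma)$ in $K_0(\mathrm{Sch}_{\mathbb F_1})$ is $$[\Gamma]_{\mathbb F_1}=\sum_{i=1}^k n_i\,\underline{\mathbb L}^{d_i}-I\cdot\underline{\mathbb L}+I+E .$$
   Context: A loose graph is a triple $(V,E,\mathbf I)$ of vertices, edges and a symmetric incidence relation between vertices and edges such that each edge is incident with at most two distinct vertices (so an edge may have two, one or no vertices); no loops, undirected. A loose tree is a connected loose graph in which any two vertices are connected by a unique simple path (edges with fewer than two vertices are allowed). The degree $\deg(v)$ is the number of edges incident with $v$. An $\mathbb F_1$-ring is a commutative monoid with absorbing element $0$; Deitmar schemes are locally monoidal spectra of $\mathbb F_1$-rings. The ambient space of $\Gamma$: let $\overline\Gamma$ be the graph obtained by adding a second, new vertex to each edge having only one vertex (and two new vertices to each edge having none), with vertex set $\overline V$; then $\mathbf P(\Gamma)=\mathrm{Proj}(\mathbb F_1[X_w]_{w\in\overline V})$ is the projective space over $\mathbb F_1$ with one coordinate per element of $\overline V$. The functor $\mathcal F$: for $v\in V$ let $\mathbb A_v\subset\mathbf P(\Gamma)$ be the affine space of dimension $\deg(v)$ given by $X_v\ne0$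 and $X_w=0$ for every $w\in\overline V\setminus\{v\}$ not adjacent to $v$ in $\overline\Gamma$; an edge with no vertices, with added ends $a,b$, gives the multiplicative group $X_aX_b\neq 0$, all other coordinates $0$. $\mathcal F(\Gamma)$ is the union of all these (constructible) pieces inside $\mathbf P(\Gamma)$. $K_0(\mathrm{Sch}_{\mathbb F_1})$ is the ring generated by isomorphism classes $[X]_{\mathbb F_1}$ of schemes of finite type over $\mathbb F_1$ with relations $[X]_{\mathbb F_1}=[X\setminus Y]_{\mathbb F_1}+[Y]_{\mathbb F_1}$ for $Y$ closed in $X$, and product $[X]_{\mathbb F_1}[Y]_{\mathbb F_1}=[X\times_{\mathbb F_1}Y]_{\mathbb F_1}$; $\underline{\mathbb L}=[\mathbb A^1_{\mathbb F_1}]_{\mathbb F_1}$.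
   Formalization: The loose tree is required to have at least one edge: for the tree with a single vertex and no edge the stated formula gives L − 1, whereas the class is that of a point, namely 1, so the claim fails in exactly that case. *)

(* Defs.v *)
From HB Require Import structures.
From mathcomp Require Import all_boot all_order all_algebra.
From mathcomp Require Import boolp classical_sets.

Set Implicit Arguments.
Unset Strict Implicit.
Unset Printing Implicit Defensive.

Import GRing.Theory.

Local Open Scope classical_set_scope.

#[local] Obligation Tactic := idtac.

(* The zero ring, in which 1 = 0, is allowed; its spectrum is empty. *)
Record F1ring := MkF1ring {
  fcar :> Type;
  fone : fcar;
  fzero : fcar;
  fmul : fcar -> fcar -> fcar;
  fmulA : associative fmul;
  fmulC : commutative fmul;
  fmul1 : left_id fone fmul;
  fmul0 : left_zero fzero fmul }.

Arguments fone {_}.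
Arguments fzero {_}.

Declare Scope F1_scope.
Delimit Scope F1_scope with F1.
Notation "1" := fone : F1_scope.
Notation "0" := fzero : F1_scope.
Notation "x * y" := (fmul x y) : F1_scope.
Local Open Scope F1_scope.

Record is_F1hom (A B : F1ring) (f : A -> B) : Prop := {
  hom1 : f 1 = 1;
  hom0 : f 0 = 0;
  homM : forall a b, f (a * b) = f a * f b }.

Definition is_funit (A : F1ring) (a : A) : Prop := exists b : A, a * b = 1.

Definition fin_gen (A : F1ring) : Prop :=
  exists n (x : 'I_n -> A), forall P : A -> Prop,
    P 0 -> P 1 -> (forall i a, P a -> P (x i * a)) -> forall a, P a.

(* Spaces with a sheaf of F_1-rings.  The sheaf is presented by its étalé
   space: its stalks, and for each open U the sections over U viewed inside
   the product of the stalks.  A section over U is given by a family defined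
   at every point, of which only the values on U matter ([sec_ext]; a family
   given on U only can be extended by 0), and [sec U] is meaningful only for U
   open. *)

Record monoidalSpace := MonoidalSpace {
  pt :> Type;
  op : set (set pt);
  opT : op setT;
  opI : forall U V, op U -> op V -> op (U `&` V);
  op_union : forall F : set (set pt),
    (forall U, F U -> op U) -> op [set x | exists2 U, F U & U x];
  stalk : pt -> F1ring;
  sec : set pt -> (forall x, stalk x) -> Prop;
  sec_ext : forall U s t, (forall x, U x -> s x = t x) -> sec U s -> sec U t;
  sec_res : forall U V s, op U -> op V -> V `<=` U -> sec U s -> sec V s;
  sec_glue : forall U s, op U ->
    (forall x, U x -> exists V, [/\ op V, V x, V `<=` U & sec V s]) -> sec U s;
  sec1 : forall U, op U -> sec U (fun x => 1);
  sec0 : forall U, op U -> sec U (fun x => 0);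
  secM : forall U s t, op U -> sec U s -> sec U t ->
    sec U (fun x => s x * t x);
  germ_ex : forall x (a : stalk x),
    exists U s, [/\ op U, U x, sec U s & s x = a];
  germ_eq : forall U s t x, op U -> U x -> sec U s -> sec U t -> s x = t x ->
    exists V, [/\ op V, V x, V `<=` U & forall y, V y -> s y = t y] }.

Arguments op {_}.
Arguments stalk {_}.
Arguments sec {_}.

(* Morphisms are local; the map of sheaves is given on stalks and must send
   sections to sections. *)
Record mor (X Y : monoidalSpace) := Mor {
  mfun :> X -> Y;
  pull : forall x, stalk (mfun x) -> stalk x;
  mor_cont : forall U, op U -> op (mfun @^-1` U);
  pull_hom : forall x, is_F1hom (@pull x);
  pull_local : forall x a, is_funit (@pull x a) -> is_funit a;
  pull_sec : forall U s, op U -> sec U s ->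
    sec (mfun @^-1` U) (fun x => @pull x (s (mfun x))) }.

Arguments pull {_ _} _ _ _.

Program Definition idm (X : monoidalSpace) : mor X X :=
  @Mor X X (fun x => x) (fun _ a => a) _ _ _ _.
Next Obligation. by []. Qed.
Next Obligation. by []. Qed.
Next Obligation. by []. Qed.
Next Obligation. by []. Qed.

Program Definition comp (X Y Z : monoidalSpace) (g : mor Y Z) (f : mor X Y) :
    mor X Z :=
  @Mor X Z (fun x => g (f x)) (fun x a => pull f x (pull g (f x) a)) _ _ _ _.
Next Obligation. by move=> X Y Z g f U oU; exact: (mor_cont f (mor_cont g oU)). Qed.
Next Obligation.
move=> X Y Z g f x; have [f1 f0 fM] := pull_hom f x.
have [g1 g0 gM] := pull_hom g (f x).
by split=> [||a b]; rewrite ?g1 ?g0 ?gM.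
Qed.
Next Obligation. by move=> X Y Z g f x a /pull_local /pull_local. Qed.
Next Obligation.
move=> X Y Z g f U s oU sU.
exact: (pull_sec f (mor_cont g oU) (pull_sec g oU sU)).
Qed.

Definition isoSpace (X Y : monoidalSpace) : Prop :=
  exists (f : mor X Y) (g : mor Y X), comp g f = idm X /\ comp f g = idm Y.

(* Immersion of a locally closed subspace.  On stalks the map is, up to
   isomorphism, the quotient A -> A/I collapsing an ideal I to 0; surjectivity
   alone would also allow quotients by arbitrary congruences, which do not
   correspond to closed subschemes cut out by ideals. *)
Record immersion (Y X : monoidalSpace) (i : mor Y X) : Prop := {
  imm_inj : injective i;
  imm_emb : forall V, op V -> exists2 U, op U & V = i @^-1` U;
  imm_lclosed : exists U Z, [/\ op U, op (~` Z) & range i = U `&` Z];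
  imm_surj : forall y (b : stalk y), exists a, pull i y a = b;
  imm_ideal : forall y a b, pull i y a = pull i y b ->
    a = b \/ pull i y a = 0 }.

Definition closed_immersion (Y X : monoidalSpace) (i : mor Y X) : Prop :=
  immersion i /\ op (~` range i).

Definition open_immersion (Y X : monoidalSpace) (i : mor Y X) : Prop :=
  [/\ immersion i, op (range i) & forall y, injective (pull i y)].

(* Since every element of a graded F_1-ring is homogeneous,
   so is every ideal.  Spec and Proj are instances of one construction: a set D
   of primes with the Zariski topology, and the sheaf whose stalk at p is the
   degree 0 part of the localization at p. *)

Record prime_ideal (A : F1ring) (p : A -> Prop) : Prop := {
  prime0 : p 0;
  prime_mul : forall a b, p a -> p (a * b);
  prime1 : ~ p 1;
  primeP : forall a b, p (a * b) -> p a \/ p b }.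

(* The degree of 0 is irrelevant. *)
Record grading (A : F1ring) := Grading {
  gdeg :> A -> nat;
  gdegM : forall a b, a * b <> 0 -> gdeg (a * b) = (gdeg a + gdeg b)%N }.

Section Fractions.
Variables (A : F1ring) (g : grading A) (D : (A -> Prop) -> Prop).

Definition fr_pt := {p : A -> Prop | prime_ideal p /\ D p}.

Definition fr_ideal (x : fr_pt) : A -> Prop := proj1_sig x.

Definition fr_op (U : set fr_pt) : Prop :=
  exists I : A -> Prop, U = [set x | exists2 f, I f & ~ fr_ideal x f].

Definition fr_ok (x : fr_pt) (a s : A) : Prop :=
  ~ fr_ideal x s /\ (a = 0 \/ g a = g s).

Definition fr_eq (x : fr_pt) (a s b t : A) : Prop :=
  exists2 u, ~ fr_ideal x u & u * (a * t) = u * (b * s).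

(* [fr_class x a s] is the class of a/s as a set of pairs. *)
Definition fr_class (x : fr_pt) (a s : A) : A -> A -> Prop :=
  fun b t => fr_ok x b t /\ fr_eq x a s b t.

Definition fr_car (x : fr_pt) :=
  {P : A -> A -> Prop | exists a s, fr_ok x a s /\ P = fr_class x a s}.

(* z = a/s *)
Definition is_frac x (z : fr_car x) (a s : A) : Prop := proj1_sig z a s.

Definition mk_frac x a s (H : fr_ok x a s) : fr_car x :=
  exist _ (fr_class x a s) (ex_intro _ a (ex_intro _ s (conj H erefl))).

Lemma fmulr1 (a : A) : a * 1 = a. Proof. by rewrite fmulC fmul1. Qed.
Lemma fmulr0 (a : A) : a * 0 = 0. Proof. by rewrite fmulC fmul0. Qed.
Lemma fmulCA (a b c : A) : a * (b * c) = b * (a * c).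
Proof. by rewrite fmulA (fmulC a) -fmulA. Qed.
Lemma fmulACA (a b c d : A) : (a * b) * (c * d) = (a * c) * (b * d).
Proof. by rewrite -!fmulA (fmulCA b). Qed.

Lemma fr_prime (x : fr_pt) : prime_ideal (fr_ideal x).
Proof. by case: (proj2_sig x). Qed.

Lemma fr_idealM (x : fr_pt) a b :
  ~ fr_ideal x a -> ~ fr_ideal x b -> ~ fr_ideal x (a * b).
Proof. by move=> na nb /(primeP (fr_prime x)) []. Qed.

Lemma fr_ideal_neq0 (x : fr_pt) a : ~ fr_ideal x a -> a <> 0.
Proof. by move=> na a0; apply: na; rewrite a0; exact: prime0 (fr_prime x). Qed.

Lemma fr_eq_refl x a s : fr_eq x a s a s.
Proof. by exists 1 => //; apply: prime1; apply: fr_prime. Qed.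

Lemma fr_eq_sym x a s b t : fr_eq x a s b t -> fr_eq x b t a s.
Proof. by case=> u nu e; exists u. Qed.

Lemma fr_eq_trans x a s b t c w : ~ fr_ideal x t ->
  fr_eq x a s b t -> fr_eq x b t c w -> fr_eq x a s c w.
Proof.
move=> nt [u nu eu] [v nv ev]; exists (t * (u * v)).
  by do 2?apply: fr_idealM.
have -> : t * (u * v) * (a * w) = v * w * (u * (a * t)).
  rewrite -!fmulA [in RHS](fmulCA w) [in RHS](fmulCA v) (fmulCA t).
  congr (_ * _); rewrite (fmulCA t); congr (_ * _).
  by rewrite (fmulCA t) (fmulCA w) [w * t]fmulC.
rewrite eu.
have -> : v * w * (u * (b * s)) = u * s * (v * (b * w)).
  rewrite -!fmulA (fmulCA w) (fmulCA v); congr (_ * _).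
  rewrite (fmulCA s) ; congr (_ * _).
  by rewrite fmulCA (fmulCA s) [w * s]fmulC.
rewrite ev -!fmulA (fmulCA t); congr (_ * _).
rewrite (fmulCA s) (fmulCA t); congr (_ * _).
by rewrite (fmulCA s) (fmulCA t) [t * s]fmulC.
Qed.

Lemma fr_ok1 x : fr_ok x 1 1.
Proof. by split; [apply: prime1; apply: fr_prime | right]. Qed.

Lemma fr_ok0 x : fr_ok x 0 1.
Proof. by split; [apply: prime1; apply: fr_prime | left]. Qed.

Lemma fr_okM x a s b t : fr_ok x a s -> fr_ok x b t -> fr_ok x (a * b) (s * t).
Proof.
move=> [ns ha] [nt hb]; have nst := fr_idealM ns nt; split=> //.
have [->|nab] := pselect (a * b = 0); [by left | right].
rewrite !gdegM //; last exact: fr_ideal_neq0 nst.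
case: ha => [a0|->]; first by case: nab; rewrite a0 fmul0.
by case: hb => [b0|-> //]; case: nab; rewrite b0 fmulr0.
Qed.

Lemma is_frac_ok x (z : fr_car x) a s : is_frac z a s -> fr_ok x a s.
Proof. by case: z => P [b [t [ok e]]]; rewrite /is_frac /= e => -[]. Qed.

Lemma is_frac_ex x (z : fr_car x) : exists a s, is_frac z a s.
Proof.
case: z => P [a [s [ok e]]]; exists a, s; rewrite /is_frac /= e.
by split=> //; apply: fr_eq_refl.
Qed.

Lemma is_frac_mk x a s (H : fr_ok x a s) : is_frac (mk_frac H) a s.
Proof. by split=> //; apply: fr_eq_refl. Qed.

Lemma is_fracE x (z : fr_car x) a s b t :
  is_frac z a s -> is_frac z b t <-> (fr_ok x b t /\ fr_eq x a s b t).
Proof.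
case: z => P [c [w [okc e]]]; rewrite /is_frac /= e => -[oka eca].
split=> -[okb eb]; split=> //.
  by apply: (fr_eq_trans _ (fr_eq_sym eca) eb); case: okc.
by apply: (fr_eq_trans _ eca eb); case: oka.
Qed.

Lemma is_frac_inj x (y z : fr_car x) a s :
  is_frac y a s -> is_frac z a s -> y = z.
Proof.
move=> ya za; have E b t : is_frac y b t = is_frac z b t.
  apply/propext.
  exact: iff_trans (is_fracE b t ya) (iff_sym (is_fracE b t za)).
case: y z E {ya za} => [P hP] [Q hQ] E; apply: eq_exist.
by apply/funext => b; apply/funext => t; apply: E.
Qed.

Lemma fr_eqM x a s b t a' s' b' t' : fr_eq x a s a' s' -> fr_eq x b t b' t' ->
  fr_eq x (a * b) (s * t) (a' * b') (s' * t').
Proof.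
move=> [u nu eu] [v nv ev]; exists (u * v); first exact: fr_idealM.
by rewrite (fmulACA a) fmulACA eu ev fmulACA (fmulACA a').
Qed.

Lemma fr_mul_subproof x (y z : fr_car x) : exists a s, fr_ok x a s /\
  (fun c w => exists a s b t, [/\ is_frac y a s, is_frac z b t &
     fr_class x (a * b) (s * t) c w]) = fr_class x a s.
Proof.
have [a [s ya]] := is_frac_ex y; have [b [t zb]] := is_frac_ex z.
have ok := fr_okM (is_frac_ok ya) (is_frac_ok zb).
exists (a * b), (s * t); split=> //.
apply/funext => c; apply/funext => w; apply/propext; split; last first.
  by move=> h; exists a, s, b, t.
move=> [a' [s' [b' [t' [ya' zb' [okc e]]]]]]; split=> //.
have ok' := fr_okM (is_frac_ok ya') (is_frac_ok zb').
apply: fr_eq_trans e; first by case: ok'.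
apply: fr_eqM; first by case/(is_fracE a' s' ya): ya'.
by case/(is_fracE b' t' zb): zb'.
Qed.

Definition fr_mul x (y z : fr_car x) : fr_car x :=
  exist _ _ (fr_mul_subproof y z).

Lemma is_fracM x (y z : fr_car x) a s b t :
  is_frac y a s -> is_frac z b t -> is_frac (fr_mul y z) (a * b) (s * t).
Proof.
move=> ya zb; exists a, s, b, t; split=> //; split; last exact: fr_eq_refl.
exact: fr_okM (is_frac_ok ya) (is_frac_ok zb).
Qed.

Program Definition fr_stalk (x : fr_pt) : F1ring :=
  @MkF1ring (fr_car x) (mk_frac (fr_ok1 x)) (mk_frac (fr_ok0 x)) (@fr_mul x)
    _ _ _ _.
Next Obligation.
move=> x y z w; have [a [s ya]] := is_frac_ex y.
have [b [t zb]] := is_frac_ex z; have [c [u wc]] := is_frac_ex w.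
apply: is_frac_inj (is_fracM ya (is_fracM zb wc)) _.
by rewrite !fmulA; do 2!apply: is_fracM => //.
Qed.
Next Obligation.
move=> x y z; have [a [s ya]] := is_frac_ex y.
have [b [t zb]] := is_frac_ex z.
apply: is_frac_inj (is_fracM ya zb) _.
by rewrite (fmulC a) (fmulC s); apply: is_fracM.
Qed.
Next Obligation.
move=> x y; have [a [s ya]] := is_frac_ex y.
apply: (@is_frac_inj x _ _ a s); last exact: ya.
by have := is_fracM (is_frac_mk (fr_ok1 x)) ya; rewrite !fmul1.
Qed.
Next Obligation.
move=> x y; have [a [s ya]] := is_frac_ex y.
have := is_fracM (is_frac_mk (fr_ok0 x)) ya; rewrite fmul0 fmul1 => h.
apply: is_frac_inj h _; apply/(is_fracE 0 s (is_frac_mk (fr_ok0 x))).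
split; last by exists 1; [apply: prime1; apply: fr_prime | rewrite !fmul0].
by case: (is_frac_ok ya) => ns _; split=> //; left.
Qed.

Definition fr_sec (U : set fr_pt) (s : forall x, fr_stalk x) : Prop :=
  forall x, U x -> exists V, [/\ fr_op V, V x, V `<=` U &
    exists a b, forall y, V y -> is_frac (s y) a b].

Lemma fr_opT : fr_op setT.
Proof.
exists (fun a => a = 1); apply/seteqP; split=> // x _.
by exists 1 => //; apply: prime1; apply: fr_prime.
Qed.

Lemma fr_opI U V : fr_op U -> fr_op V -> fr_op (U `&` V).
Proof.
move=> [I ->] [J ->].
exists (fun a => exists b c, [/\ I b, J c & a = b * c]).
apply/seteqP; split=> x /=.
  by move=> [[b Ib nb] [c Jc nc]]; exists (b * c);
    [exists b, c | apply: fr_idealM].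
move=> [_ [b [c [Ib Jc ->]]] nbc]; split; [exists b | exists c] => // h.
  by apply: nbc; apply: (prime_mul (fr_prime x)).
by apply: nbc; rewrite fmulC; apply: (prime_mul (fr_prime x)).
Qed.

Lemma fr_op_union (F : set (set fr_pt)) :
  (forall U, F U -> fr_op U) -> fr_op [set x | exists2 U, F U & U x].
Proof.
move=> oF; exists (fun a => exists2 U, F U & forall x, ~ fr_ideal x a -> U x).
apply/seteqP; split=> x /=.
  move=> [U FU Ux]; have [I UE] := oF _ FU; move: (Ux); rewrite {1}UE.
  by move=> [a Ia na]; exists a => //; exists U => // y ny; rewrite UE; exists a.
by move=> [a [U FU h] na]; exists U => //; apply: h.
Qed.

Program Definition fr_space : monoidalSpace :=
  @MonoidalSpace fr_pt fr_op fr_opT fr_opI fr_op_union fr_stalk fr_sec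
    _ _ _ _ _ _ _ _.
Next Obligation.
move=> U s t e sU x /sU [V [oV Vx VU [a [b h]]]].
by exists V; split=> //; exists a, b => y Vy; rewrite -e; [apply: h | apply: VU].
Qed.
Next Obligation.
move=> U V s _ oV VU sU x Vx; have [W [oW Wx WU [a [b h]]]] := sU _ (VU _ Vx).
exists (V `&` W); split=> //; first exact: fr_opI.
by exists a, b => y [_ /h].
Qed.
Next Obligation.
move=> U s _ h x /h [V [oV Vx VU sV]]; have [W [oW Wx WV fW]] := sV _ Vx.
by exists W; split=> // y /WV /VU.
Qed.
Next Obligation.
move=> U oU x Ux; exists U; split=> //; exists 1, 1 => y _; exact: is_frac_mk.
Qed.
Next Obligation.
move=> U oU x Ux; exists U; split=> //; exists 0, 1 => y _; exact: is_frac_mk.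
Qed.
Next Obligation.
move=> U s t oU sU tU x Ux; have [V [oV Vx VU [a [b hs]]]] := sU _ Ux.
have [W [oW Wx WU [c [d ht]]]] := tU _ Ux.
exists (V `&` W); split=> //; first exact: fr_opI.
  by move=> y [/VU].
by exists (a * c), (b * d) => y [/hs ? /ht ?]; apply: is_fracM.
Qed.
Next Obligation.
move=> x z; have [a [b zab]] := is_frac_ex z; have [nb hab] := is_frac_ok zab.
pose s (y : fr_pt) : fr_stalk y := match pselect (fr_ok y a b) with
  | left H => mk_frac H | right _ => 0 end.
have sE y : ~ fr_ideal y b -> is_frac (s y) a b.
  rewrite /s => nyb; case: pselect => [H|[]//]; exact: is_frac_mk.
have oV : fr_op [set y | ~ fr_ideal y b].
  exists (fun c => c = b); apply/seteqP; split=> y /=; first by exists b.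
  by case=> _ ->.
exists [set y | ~ fr_ideal y b], s; split=> //.
- by move=> y ny; exists [set y | ~ fr_ideal y b]; split=> //; exists a, b.
- by apply: is_frac_inj zab; apply: sE.
Qed.
Next Obligation.
move=> U s t x oU Ux sU tU e; have [V [oV Vx VU [a [b hs]]]] := sU _ Ux.
have [W [oW Wx WU [c [d ht]]]] := tU _ Ux.
have := hs _ Vx; rewrite e => hx.
have [_ [u nu eu]] := (is_fracE c d hx).1 (ht _ Wx).
exists (V `&` W `&` [set y | ~ fr_ideal y u]); split=> //.
- apply: fr_opI; first exact: fr_opI.
  exists (fun v => v = u); apply/seteqP; split=> y /=; first by exists u.
  by case=> _ ->.
- by move=> y [[/VU]].
move=> y [[Vy Wy] ny]; apply: is_frac_inj (ht _ Wy).
apply/(is_fracE c d (hs _ Vy)); split; first exact: is_frac_ok (ht _ Wy).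
by exists u.
Qed.

End Fractions.

Program Definition triv_grading (A : F1ring) : grading A :=
  @Grading A (fun=> 0%N) _.
Next Obligation. by []. Qed.

Definition Spec (A : F1ring) : monoidalSpace :=
  fr_space (triv_grading A) (fun=> True).

Definition Proj (A : F1ring) (g : grading A) : monoidalSpace :=
  fr_space g (fun p => exists2 a, (0 < g a)%N & ~ p a).

Definition scheme (X : monoidalSpace) : Prop :=
  forall x : X, exists (A : F1ring) (j : mor (Spec A) X),
    open_immersion j /\ range j x.

Definition finite_type (X : monoidalSpace) : Prop :=
  exists n (A : 'I_n -> F1ring) (j : forall k, mor (Spec (A k)) X),
    (forall k, fin_gen (A k) /\ open_immersion (j k)) /\
    (forall x : X, exists k, range (j k) x).

Record schFT := SchFT {
  sch :> monoidalSpace;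
  sch_ft : finite_type sch }.

(* Spec F_1 is the terminal scheme, so the fibre product over F_1 is the
   categorical product. *)
Definition is_product (P X Y : monoidalSpace) (p : mor P X) (q : mor P Y) :
    Prop :=
  forall (Z : monoidalSpace) (f : mor Z X) (h : mor Z Y), scheme Z ->
    exists! u : mor Z P, comp p u = f /\ comp q u = h.

Lemma idm_open (X : monoidalSpace) : open_immersion (idm X).
Proof.
have rE : range (idm X) = setT by apply/seteqP; split=> // x _; exists x.
have o0 : op (~` [set: X]).
  rewrite setCT (_ : set0 = [set x | exists2 U, (@set0 (set X)) U & U x]).
    exact: op_union.
  by apply/seteqP; split=> // x [].
split; last by move=> y a b.
  split.
  - by move=> x y.
  - by move=> V oV; exists V.
  - by exists setT, setT; rewrite rE setIT; split=> //; apply: opT.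
  - by move=> y b; exists b.
  - by move=> y a b; left.
by rewrite rE; apply: opT.
Qed.

Lemma Spec_ft (A : F1ring) : fin_gen A -> finite_type (Spec A).
Proof.
move=> fA; exists 1%N, (fun=> A), (fun=> idm (Spec A)); split.
  by move=> _; split=> //; apply: idm_open.
by move=> x; exists ord0, x.
Qed.

Definition F1 : F1ring :=
  @MkF1ring bool true false andb andbA andbC andTb andFb.

Lemma F1_fg : fin_gen F1.
Proof. by exists 0%N, (fun=> true) => P P0 P1 _ []. Qed.

Definition SpecF1 : schFT := SchFT (Spec_ft F1_fg).

(* The polynomial ring F_1[X_0, ..., X_(n-1)]: 0 (as None) and the monomials,
   given by their exponents.  The index type {i | i < n}, rather than 'I_n,
   keeps the carrier in Set; this keeps the universe of schemes below that of
   the carriers of MathComp structures, so that the Grothendieck ring can be a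
   comPzRingType. *)

Definition pmul n (a b : option ({i | (i < n)%N} -> nat)) :=
  match a, b with
  | Some f, Some h => Some (fun i => f i + h i)%N
  | _, _ => None
  end.

Program Definition F1poly (n : nat) : F1ring :=
  @MkF1ring (option ({i | (i < n)%N} -> nat)) (Some (fun=> 0%N)) None (@pmul n)
    _ _ _ _.
Next Obligation.
by move=> n [f|] [h|] [k|] //=; congr Some; apply/funext => i; rewrite addnA.
Qed.
Next Obligation.
by move=> n [f|] [h|] //=; congr Some; apply/funext => i; rewrite addnC.
Qed.
Next Obligation. by move=> n [f|]. Qed.
Next Obligation. by []. Qed.

Definition F1var n (k : 'I_n) : F1poly n :=
  Some (fun i => nat_of_bool (proj1_sig i == k :> nat)).

Definition pdeg n (a : F1poly n) : nat :=
  if a is Some f then \sum_(k < n) f (exist _ (k : nat) (ltn_ord k)) else 0%N.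

Program Definition pgrading n : grading (F1poly n) :=
  @Grading (F1poly n) (@pdeg n) _.
Next Obligation. by move=> n [f|] [h|] //= _; rewrite big_split. Qed.

(* Projective space with homogeneous coordinates X_0, ..., X_(n-1). *)
Definition PP (n : nat) : monoidalSpace := Proj (pgrading n).

(* [coord0 x k]: the k-th coordinate vanishes at x. *)
Definition coord0 n (x : PP n) (k : 'I_n) : Prop := fr_ideal x (F1var k).

Lemma F1poly1_fg : fin_gen (F1poly 1).
Proof.
exists 1%N, (@F1var 1) => P P0 P1 PM [f|//].
pose i0 : {i | (i < 1)%N} := exist _ 0%N isT.
have iE i : i = i0 by case: i => -[|//] h; apply: eq_exist.
have -> : f = fun=> f i0 by apply/funext => i; rewrite (iE i).
elim: (f i0) => [//|m /(PM ord0)].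
by congr P; congr Some; apply/funext => i; rewrite (iE i).
Qed.

Definition A1 : schFT := SchFT (Spec_ft F1poly1_fg).

(* Formal expressions in the classes of schemes, modulo
   the smallest congruence making them a commutative ring with unit [Spec F_1]
   and satisfying the relations of isomorphism, cutting and product. *)

Inductive kexpr :=
| KClass of schFT
| KZero
| KOpp of kexpr
| KAdd of kexpr & kexpr
| KMul of kexpr & kexpr.

Inductive keq : kexpr -> kexpr -> Prop :=
| keq_iso (X Y : schFT) : isoSpace X Y -> keq (KClass X) (KClass Y)
| keq_cut (X Y U : schFT) (i : mor Y X) (j : mor U X) :
    closed_immersion i -> open_immersion j -> range j = ~` range i ->
    keq (KClass X) (KAdd (KClass U) (KClass Y))
| keq_prod (P X Y : schFT) (p : mor P X) (q : mor P Y) :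
    is_product p q -> keq (KMul (KClass X) (KClass Y)) (KClass P)
| keq_refl x : keq x x
| keq_sym x y : keq x y -> keq y x
| keq_trans x y z : keq x y -> keq y z -> keq x z
| keq_opp x y : keq x y -> keq (KOpp x) (KOpp y)
| keq_add x x' y y' : keq x x' -> keq y y' -> keq (KAdd x y) (KAdd x' y')
| keq_mul x x' y y' : keq x x' -> keq y y' -> keq (KMul x y) (KMul x' y')
| keq_addA x y z : keq (KAdd x (KAdd y z)) (KAdd (KAdd x y) z)
| keq_addC x y : keq (KAdd x y) (KAdd y x)
| keq_add0 x : keq (KAdd KZero x) x
| keq_addN x : keq (KAdd (KOpp x) x) KZero
| keq_mulA x y z : keq (KMul x (KMul y z)) (KMul (KMul x y) z)
| keq_mulC x y : keq (KMul x y) (KMul y x)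
| keq_mul1 x : keq (KMul (KClass SpecF1) x) x
| keq_mulDl x y z : keq (KMul (KAdd x y) z) (KAdd (KMul x z) (KMul y z)).

HB.instance Definition _ := gen_eqMixin kexpr.
HB.instance Definition _ := gen_choiceMixin kexpr.

Definition keqb (x y : kexpr) : bool := `[< keq x y >].

Lemma keqb_refl : reflexive keqb.
Proof. by move=> x; apply/asboolP; apply: keq_refl. Qed.

Lemma keqb_sym : symmetric keqb.
Proof. by move=> x y; apply/asboolP/asboolP; apply: keq_sym. Qed.

Lemma keqb_trans : transitive keqb.
Proof.
by move=> y x z /asboolP h /asboolP h'; apply/asboolP; apply: keq_trans h h'.
Qed.

Canonical keq_equiv := EquivRel keqb keqb_refl keqb_sym keqb_trans.

Definition K0 : Type := {eq_quot keq_equiv}%qT.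
HB.instance Definition _ := Choice.on K0.

Definition kpi (x : kexpr) : K0 := (\pi_({eq_quot keq_equiv}) x)%qT.

Definition krepr (x : K0) : kexpr := generic_quotient.repr x.

Lemma kpiP x y : kpi x = kpi y <-> keq x y.
Proof. by split=> [/eqquotP/asboolP | h]; last exact/eqquotP/asboolP. Qed.

Lemma kreprK x : kpi (krepr x) = x.
Proof. exact: reprK. Qed.

Definition K0zero : K0 := kpi KZero.
Definition K0one : K0 := kpi (KClass SpecF1).
Definition K0opp (x : K0) : K0 := kpi (KOpp (krepr x)).
Definition K0add (x y : K0) : K0 := kpi (KAdd (krepr x) (krepr y)).
Definition K0mul (x y : K0) : K0 := kpi (KMul (krepr x) (krepr y)).

Lemma kreprE x : keq (krepr (kpi x)) x.
Proof. by apply/kpiP; rewrite kreprK. Qed.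

Lemma kpiN x : K0opp (kpi x) = kpi (KOpp x).
Proof. by apply/kpiP/keq_opp/kreprE. Qed.

Lemma kpiD x y : K0add (kpi x) (kpi y) = kpi (KAdd x y).
Proof. by apply/kpiP/keq_add; apply: kreprE. Qed.

Lemma kpiM x y : K0mul (kpi x) (kpi y) = kpi (KMul x y).
Proof. by apply/kpiP/keq_mul; apply: kreprE. Qed.

Lemma K0addA : associative K0add.
Proof.
move=> x y z; rewrite -(kreprK x) -(kreprK y) -(kreprK z) !kpiD.
exact/kpiP/keq_addA.
Qed.

Lemma K0addC : commutative K0add.
Proof. by move=> x y; apply/kpiP/keq_addC. Qed.

Lemma K0add0 : left_id K0zero K0add.
Proof. by move=> x; rewrite -(kreprK x) kpiD; apply/kpiP/keq_add0. Qed.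

Lemma K0addN : left_inverse K0zero K0opp K0add.
Proof. by move=> x; rewrite -(kreprK x) kpiN kpiD; apply/kpiP/keq_addN. Qed.

Lemma K0mulA : associative K0mul.
Proof.
move=> x y z; rewrite -(kreprK x) -(kreprK y) -(kreprK z) !kpiM.
exact/kpiP/keq_mulA.
Qed.

Lemma K0mulC : commutative K0mul.
Proof. by move=> x y; apply/kpiP/keq_mulC. Qed.

Lemma K0mul1 : left_id K0one K0mul.
Proof. by move=> x; rewrite -(kreprK x) kpiM; apply/kpiP/keq_mul1. Qed.

Lemma K0mulDl : left_distributive K0mul K0add.
Proof.
move=> x y z; rewrite -(kreprK x) -(kreprK y) -(kreprK z) !(kpiD, kpiM).
exact/kpiP/keq_mulDl.
Qed.

HB.instance Definition _ := GRing.isZmodule.Build K0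
  K0addA K0addC K0add0 K0addN.
HB.instance Definition _ := GRing.Zmodule_isComPzRing.Build K0
  K0mulA K0mulC K0mul1 K0mulDl.

Definition classK (X : schFT) : K0 := kpi (KClass X).

Definition LL : K0 := classK A1.

(* The class of a constructible set C in X: the sum of the classes of the
   pieces of a decomposition of C into finitely many pairwise disjoint locally
   closed subschemes (it does not depend on the decomposition). *)
Definition decomp_class (X : monoidalSpace) (C : set X) (c : K0) : Prop :=
  exists m (Y : 'I_m -> schFT) (i : forall k, mor (Y k) X),
    [/\ forall k, immersion (i k),
        forall k l, k <> l -> range (i k) `&` range (i l) = set0,
        C = [set x | exists k, range (i k) x]
      & c = (\sum_(k < m) classK (Y k))%R].

Definition constr_class (X : monoidalSpace) (C : set X) : K0 :=
  xget 0%R [set c | decomp_class C c].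

Record looseGraph := LooseGraph {
  lvert : finType;
  ledge : finType;
  linc : lvert -> ledge -> bool;
  linc2 : forall e, (#|[set v | linc v e]%SET| <= 2)%N }.

Section Loose.
Variable G : looseGraph.

Definition deg (v : lvert G) : nat := #|[set e | linc v e]%SET|.

Definition lincident (x y : lvert G + ledge G) : bool :=
  match x, y with
  | inl v, inr e | inr e, inl v => linc v e
  | _, _ => false
  end.

(* Edges count for connectedness: an edge without vertices is a component. *)
Definition lconnected : Prop :=
  (0 < #|{: lvert G + ledge G}|)%N /\ forall x y, connect lincident x y.

(* v, p is the sequence v = v_0, e_1, v_1, ..., e_m, v_m = w. *)
Definition simple_path (v w : lvert G) (p : seq (lvert G + ledge G)) : Prop :=
  [/\ path lincident (inl v) p, last (inl v) p = inl w & uniq (inl v :: p)].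

Definition loose_tree : Prop :=
  lconnected /\ forall v w, exists! p, simple_path v w p.

(* Vertices of the completed graph: each edge with r < 2 vertices receives
   2 - r new ends (e, i). *)
Definition new_end (x : ledge G * 'I_2) : bool :=
  (x.2 < 2 - #|[set v | linc v x.1]%SET|)%N.

Definition bvert : finType := (lvert G + {x | new_end x})%type.

Definition binc (w : bvert) (e : ledge G) : bool :=
  match w with
  | inl v => linc v e
  | inr x => (val x).1 == e
  end.

Definition badj (w w' : bvert) : bool :=
  (w != w') && [exists e, binc w e && binc w' e].

(* The ambient space; the coordinates are indexed by the vertices of the
   completed graph through their enumeration. *)
Definition PG : monoidalSpace := PP #|bvert|.

Definition X0 (x : PG) (w : bvert) : Prop := coord0 x (enum_rank w).

Definition affine_piece (v : lvert G) : set PG :=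
  [set x | ~ X0 x (inl v) /\
           forall w : bvert, w != inl v -> ~~ badj (inl v) w -> X0 x w].

(* For an edge with no vertices, whose ends are exactly the two new ones. *)
Definition Gm_piece (e : ledge G) : set PG :=
  [set x | forall w : bvert, X0 x w <-> ~~ binc w e].

Definition calF : set PG :=
  [set x | (exists v, affine_piece v x) \/
           (exists2 e, (forall v, ~~ linc v e) & Gm_piece e x)].

Definition graph_class : K0 := constr_class calF.

End Loose.

(* Main.v *)
(* The class of a constructible subset of a projective space can be computed
   point by point.  A point x of P^(n-1) over F_1 is a nonempty set T of
   coordinates (those that do not vanish at x), and the units of its stalk form
   a free abelian group of rank |T| - 1.  An immersion Y -> P^(n-1) induces
   isomorphisms on the unit groups of the stalks, so cutting off closed points
   one at a time gives [Y] as the sum of (L - 1)^(|T| - 1) over the points of Y;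
   here [G_m] = L - 1 because A^1 has two points, and [G_m^r] = [G_m]^r.  Hence
   the class of a constructible set does not depend on its decomposition.

   For a tree, the piece at v is made of the T with v in T and T contained in
   the star of v, and the binomial formula gives it the class L^deg(v).  Since
   there are no triangles, two pieces meet only in the interior of a common
   edge, of class L - 1, and there are |V| - 1 edges with two vertices. *)

(* The obstacle is that the pieces of a decomposition are arbitrary schemes of finite type, and
   cutting off a point leaves another scheme about which nothing explicit is known. So only data
   inherited by open subspaces and immersions are carried along: finitely many labelled points, a
   rank for each, and a residue map from the stalk onto a free abelian group with zero. The residue
   is a better invariant than the stalk, since an immersion may collapse an ideal of non-units. The
   complement of a closed point needs to be of finite type again in order to have a class. This
   follows because the generizations of a point in an affine chart form its smallest neighbourhood,
   which is the spectrum of the stalk. The number of edges with two vertices comes from a root: a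
   vertex other than the root is matched with the last edge of its path from the root. *)
Require Import Defs.
From mathcomp Require Import all_boot all_order all_algebra.
From mathcomp Require Import zify ring.
From mathcomp Require Import boolp classical_sets.

Set Implicit Arguments.
Unset Strict Implicit.
Unset Printing Implicit Defensive.

Import GRing.Theory.

Local Open Scope classical_set_scope.
Local Open Scope F1_scope.

#[local] Obligation Tactic := idtac.

(** * Open subspaces and one-point spaces *)

Lemma op0 (X : monoidalSpace) : op (@set0 X).
Proof.
rewrite (_ : set0 = [set x | exists2 U, (@set0 (set X)) U & U x]).
  exact: op_union.
by apply/seteqP; split=> // x [].
Qed.

Lemma op_cap (X : monoidalSpace) (I : finType) (V : I -> set X) :
  (forall i, op (V i)) -> op [set x | forall i, V i x].
Proof.
move=> oV; suff h (s : seq I) : op [set x | forall i, i \in s -> V i x].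
  rewrite (_ : mkset _ = [set x | forall i, i \in enum I -> V i x]) //.
  by apply/seteqP; split=> x Vx i // ; apply: Vx; rewrite mem_enum.
elim: s => [|j s IH].
  by rewrite (_ : mkset _ = setT); [exact: opT | apply/seteqP; split].
rewrite (_ : mkset _ = V j `&` [set x | forall i, i \in s -> V i x]).
  exact: opI.
apply/seteqP; split=> x /=.
  by move=> h; split=> [|i si]; apply: h; rewrite inE ?eqxx ?si ?orbT.
by move=> [Vj h] i; rewrite inE => /orP[/eqP->|/h].
Qed.

Lemma open_of_nbhs (X : monoidalSpace) (U : set X) :
  (forall x, U x -> exists V, [/\ op V, V x & V `<=` U]) -> op U.
Proof.
move=> h; rewrite (_ : U = [set x | exists2 V, op V /\ V `<=` U & V x]).
  by apply: op_union => V [].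
apply/seteqP; split=> x /=; first by move=> /h[V [oV Vx VU]]; exists V.
by case=> V [_ VU] /VU.
Qed.

Lemma open_immersion_open (Y X : monoidalSpace) (j : mor Y X) V :
  open_immersion j -> op V -> op (j @` V).
Proof.
move=> [im oj _] /(imm_emb im)[U oU ->].
rewrite (_ : _ @` _ = U `&` range j); first exact: opI.
apply/seteqP; split=> x; first by case=> y Uy <-; split=> //; exists y.
by case=> Ux [y _ e]; exists y => //=; rewrite e.
Qed.

Lemma open_immersion_intro (Y X : monoidalSpace) (j : mor Y X) :
    injective j -> (forall V, op V -> op (j @` V)) ->
    (forall y b, exists a, pull j y a = b) -> (forall y, injective (pull j y)) ->
  open_immersion j.
Proof.
move=> ij oj sj pj; have oR : op (range j) by apply: oj; apply: opT.
split=> //; split=> //.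
- move=> V oV; exists (j @` V); first exact: oj.
  apply/seteqP; split=> y Vy; first by exists y.
  by case: Vy => z Vz /ij <-.
- exists (range j), setT; split=> //; last by rewrite setIT.
  by rewrite setCT; apply: op0.
- by move=> y a b /pj; left.
Qed.

Lemma open_immersion_comp (Z Y X : monoidalSpace) (j : mor Y X) (i : mor Z Y) :
  open_immersion j -> open_immersion i -> open_immersion (Defs.comp j i).
Proof.
move=> oj oi; have [ij _ pj] := oj; have [ii _ qi] := oi.
apply: open_immersion_intro.
- by move=> x y /= /(imm_inj ij)/(imm_inj ii).
- move=> V oV; have := open_immersion_open oj (open_immersion_open oi oV).
  congr op; apply/seteqP; split=> x; first by case=> _ [z Vz <-] <-; exists z.
  by case=> z Vz <-; exists (i z) => //; exists z.
- move=> y c; have [b <-] := imm_surj ii c; have [a <-] := imm_surj ij b.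
  by exists a.
- by move=> y a b /= /qi /pj.
Qed.

Section OpenSubspace.
Variables (X : monoidalSpace) (U : set X) (oU : op U).

Definition osub_img (V : set {x | U x}) : set X :=
  [set x | exists h : U x, V (exist _ x h)].

(** Sections of X are families over all of X, so a family over U is extended by 0; by [sec_ext] the
    values outside U do not matter. *)
Definition osub_ext (s : forall y : {x | U x}, stalk (proj1_sig y)) (x : X) :
    stalk x :=
  match pselect (U x) with
  | left h => s (exist _ x h)
  | right _ => 0
  end.

Lemma osub_extE s x (h : U x) : osub_ext s x = s (exist _ x h).
Proof.
rewrite /osub_ext; case: pselect => [h'|//].
by rewrite (Prop_irrelevance h' h).
Qed.

Lemma osub_imgE V x (h : U x) : osub_img V x = V (exist _ x h).
Proof.
by apply/propext; split=> [[h']|Vx]; [rewrite (Prop_irrelevance h' h)|exists h].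
Qed.

Program Definition osub : monoidalSpace :=
  @MonoidalSpace {x | U x} (fun V => op (osub_img V)) _ _ _
    (fun y => stalk (proj1_sig y))
    (fun V s => sec (osub_img V) (osub_ext s)) _ _ _ _ _ _ _ _.
Next Obligation.
rewrite /= (_ : osub_img _ = U) //; apply/seteqP; split=> x; first by case.
by move=> h; exists h.
Qed.
Next Obligation.
move=> V W oV oW; rewrite /= (_ : osub_img _ = osub_img V `&` osub_img W).
  exact: opI.
apply/seteqP; split=> x; first by case=> h [Vx Wx]; split; exists h.
by case=> -[h Vx]; rewrite (osub_imgE _ h) => Wx; exists h.
Qed.
Next Obligation.
move=> F oF.
rewrite /= (_ : osub_img _ =
  [set x | exists2 W, (exists2 V, F V & W = osub_img V) & W x]).
  by apply: op_union => _ [V /oF oV ->].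
apply/seteqP; split=> x /=.
  by case=> h [V FV Vx]; exists (osub_img V); [exists V | exists h].
by case=> _ [V FV ->] [h Vx]; exists h, V.
Qed.
Next Obligation.
move=> V s t e; apply: sec_ext => x [h Vx].
by rewrite !(osub_extE _ h) e.
Qed.
Next Obligation.
move=> V W s oV oW WV; apply: sec_res => // x [h Wx]; exists h; exact: WV.
Qed.
Next Obligation.
move=> V s oV h; apply: sec_glue => // x [hx Vx].
have [W [oW Wx WV sW]] := h _ Vx; exists (osub_img W); split=> //.
  by exists hx.
by move=> y [hy Wy]; exists hy; apply: WV.
Qed.
Next Obligation.
move=> V oV; apply: sec_ext (sec1 oV) => x [h _].
by rewrite (osub_extE _ h).
Qed.
Next Obligation.
move=> V oV; apply: sec_ext (sec0 oV) => x [h _].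
by rewrite (osub_extE _ h).
Qed.
Next Obligation.
move=> V s t oV sV tV; apply: sec_ext (secM oV sV tV) => x [h _].
by rewrite !(osub_extE _ h).
Qed.
Next Obligation.
move=> [x Ux] a; have [V [s [oV Vx sV sx]]] := germ_ex a.
have E : osub_img [set y | V (proj1_sig y)] = U `&` V.
  by apply/seteqP; split=> y [h Vy]; [split|exists h].
exists [set y | V (proj1_sig y)], (fun y => s (proj1_sig y)).

rewrite !E; split=> //; first exact: opI.
apply: (sec_ext (s := s)); first by move=> y [h _]; rewrite (osub_extE _ h).
by apply: sec_res sV => //; apply: opI.
Qed.
Next Obligation.
move=> V s t [x Ux] oV Vx sV tV e.
have Vx' : osub_img V x by exists Ux.
have e' : osub_ext s x = osub_ext t x by rewrite !(osub_extE _ Ux).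
have [W [oW Wx WV h]] := germ_eq oV Vx' sV tV e'.
exists [set y | W (proj1_sig y)]; split=> //.
- rewrite (_ : osub_img _ = U `&` W); first exact: opI.
  by apply/seteqP; split=> y [hy Wy]; [split|exists hy].
- by move=> [y Uy] /WV; rewrite (osub_imgE _ Uy).
- by move=> [y Uy] /h; rewrite !(osub_extE _ Uy).
Qed.

Program Definition osub_inc : mor osub X :=
  @Mor osub X (fun y => proj1_sig y) (fun _ a => a) _ _ _ _.
Next Obligation.
move=> V oV; rewrite /op /= (_ : osub_img _ = U `&` V); first exact: opI.
by apply/seteqP; split=> y [hy Vy]; [split|exists hy].
Qed.
Next Obligation. by []. Qed.
Next Obligation. by []. Qed.
Next Obligation.
move=> V s oV sV; rewrite /sec /= (_ : osub_img _ = U `&` V); last first.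
  by apply/seteqP; split=> y [hy Vy]; [split|exists hy].
apply: (sec_ext (s := s)); first by move=> y [h _]; rewrite (osub_extE _ h).
by apply: sec_res sV => //; apply: opI.
Qed.

Lemma osub_inc_range : range osub_inc = U.
Proof.
by apply/seteqP; split=> x; [case=> -[y h] _ <-|move=> h; exists (exist _ x h)].
Qed.

Lemma osub_inc_open : open_immersion osub_inc.
Proof.
apply: open_immersion_intro => //.
- by move=> [x h] [y k] /= e; apply: eq_exist.
- move=> V oV; rewrite (_ : _ @` _ = osub_img V) //.
  apply/seteqP; split=> x; first by case=> -[y h] Vy <-; exists h.
  by case=> h Vx; exists (exist _ x h).
- by move=> y b; exists b.
- by move=> y a b.
Qed.

Section Corestriction.
Variables (Z : monoidalSpace) (j : mor Z X) (jU : forall z, U (j z)).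

(** Turns a chart of X that lands in U into a chart of the open subspace. *)
Program Definition corestr : mor Z osub :=
  @Mor Z osub (fun z => exist _ (j z) (jU z)) (pull j) _ _ _ _.
Next Obligation.
move=> V oV; rewrite (_ : _ @^-1` _ = j @^-1` (osub_img V)).
  exact: mor_cont.
by apply/seteqP; split=> z /=; rewrite (osub_imgE _ (jU z)).
Qed.
Next Obligation. by move=> z; apply: pull_hom. Qed.
Next Obligation. by move=> z a; apply: pull_local. Qed.
Next Obligation.
move=> V s oV sV; rewrite (_ : _ @^-1` _ = j @^-1` (osub_img V)); last first.
  by apply/seteqP; split=> z /=; rewrite (osub_imgE _ (jU z)).
by apply: sec_ext (pull_sec j oV sV) => z _; rewrite (osub_extE _ (jU z)).
Qed.

Lemma corestr_open : open_immersion j -> open_immersion corestr.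
Proof.
move=> oj; have [ij _ pj] := oj; apply: open_immersion_intro => //.
- by move=> x y [] /(imm_inj ij).
- move=> V oV; have := open_immersion_open oj oV; congr op.
  apply/seteqP; split=> x; first by case=> z Vz <-; exists (jU z), z.
  by case=> h [z Vz [e]]; exists z.
- by move=> y b; apply: (imm_surj ij).
Qed.

End Corestriction.
End OpenSubspace.

(* The one-point space with stalk A, isomorphic to the spectrum of A when every
   nonzero element of A is a unit. *)
Program Definition ptS (A : F1ring) : monoidalSpace :=
  @MonoidalSpace unit (fun=> True) I _ _ (fun=> A) (fun _ _ => True)
    _ _ _ _ _ _ _ _.
Next Obligation. by []. Qed.
Next Obligation. by []. Qed.
Next Obligation. by []. Qed.
Next Obligation. by []. Qed.
Next Obligation. by []. Qed.
Next Obligation. by []. Qed.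
Next Obligation. by []. Qed.
Next Obligation. by []. Qed.
Next Obligation. by move=> A x a; exists setT, (fun=> a). Qed.
Next Obligation.
by move=> A U s t [] _ Ux _ _ e; exists [set tt]; split=> // -[].
Qed.

(** When K is a group with zero, such an f sends all non-units to 0 and is bijective on units: an
    analogue of the map from a local ring to its residue field. The last two fields are those that
    [immersion] asks of stalk maps. *)
Record is_residue (A K : F1ring) (f : A -> K) : Prop := {
  res_hom : is_F1hom f;
  res_local : forall a, is_funit (f a) -> is_funit a;
  res_surj : forall b, exists a, f a = b;
  res_ideal : forall a b, f a = f b -> a = b \/ f a = 0 }.

Section PointImmersion.
Variables (X : monoidalSpace) (x : X) (K : F1ring) (f : stalk x -> K).
Hypothesis rf : is_residue f.

Program Definition pt_mor : mor (ptS K) X :=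
  @Mor (ptS K) X (fun=> x) (fun=> f) _ _ _ _.
Next Obligation. by []. Qed.
Next Obligation. by move=> ?; apply: res_hom rf. Qed.
Next Obligation. by move=> ?; apply: res_local rf. Qed.
Next Obligation. by []. Qed.

Lemma pt_mor_range : range pt_mor = [set x].
Proof. by apply/seteqP; split=> y; [case=> ? _ <-|move=> ->; exists tt]. Qed.

Lemma pt_mor_immersion U Z :
  op U -> op (~` Z) -> U `&` Z = [set x] -> immersion pt_mor.
Proof.
move=> oU oZ E; split.
- by move=> [] [].
- move=> V _; have [Vt|nV] := pselect (V tt).
    by exists setT; [apply: opT | apply/seteqP; split=> -[]].
  by exists set0; [apply: op0 | apply/seteqP; split=> -[]].
- by exists U, Z; rewrite E pt_mor_range.
- by move=> y; apply: (res_surj rf).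
- by move=> y; apply: (res_ideal rf).
Qed.

Lemma pt_mor_closed : op (~` [set x]) -> closed_immersion pt_mor.
Proof.
move=> cx; split; last by rewrite pt_mor_range.
by apply: (@pt_mor_immersion setT [set x]); rewrite ?setTI //; apply: opT.
Qed.

End PointImmersion.

(** * Morphisms of spectra and localization *)

Lemma funitM (A : F1ring) (a b : A) :
  is_funit (a * b) <-> is_funit a /\ is_funit b.
Proof.
split=> [[c abc]|[[c ac] [d bd]]].
  split; first by exists (b * c); rewrite fmulA.
  by exists (a * c); rewrite fmulA (fmulC b).
by exists (c * d); rewrite fmulACA ac bd fmul1.
Qed.

Lemma funit_hom (A B : F1ring) (f : A -> B) a :
  is_F1hom f -> is_funit a -> is_funit (f a).
Proof. by move=> [f1 _ fM] [b ab]; exists (f b); rewrite -fM ab. Qed.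

Lemma prime_unit (A : F1ring) (p : A -> Prop) a :
  prime_ideal p -> is_funit a -> ~ p a.
Proof. by move=> pp [b ab] pa; apply: (prime1 pp); rewrite -ab; apply: prime_mul. Qed.

Lemma prime_mulr (A : F1ring) (p : A -> Prop) a b :
  prime_ideal p -> p b -> p (a * b).
Proof. by move=> pp pb; rewrite fmulC; apply: prime_mul. Qed.

Lemma funit_cancel (A : F1ring) (u a b : A) :
  is_funit u -> u * a = u * b -> a = b.
Proof.
by move=> [v uv] e; rewrite -[a]fmul1 -[b]fmul1 -uv ![u * v]fmulC -!fmulA e.
Qed.

Section FractionUnits.
Variables (A : F1ring) (g : grading A) (D : (A -> Prop) -> Prop).

Lemma fr_pt_eq (x y : fr_pt D) :
  (forall a, fr_ideal x a <-> fr_ideal y a) -> x = y.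
Proof.
case: x y => [p hp] [q hq] h; apply: eq_exist.
by apply/funext => a; apply/propext; apply: h.
Qed.

(** Holds for every grading: the inverse s/a again has degree 0. *)
Lemma frac_unit (x : fr_pt D) (z : fr_stalk g x) a s :
  is_frac z a s -> is_funit z <-> ~ fr_ideal x a.
Proof.
move=> za; have px := fr_prime x; have [ns hs] := is_frac_ok za.
split=> [[w zw1]|na].
  have [b [t wb]] := is_frac_ex w.
  have h : is_frac (1 : fr_stalk g x) (a * b) (s * t).
    by rewrite -zw1; exact: is_fracM za wb.
  have [_ [u nu e]] := (is_fracE 1 1 h).1 (is_frac_mk (fr_ok1 g x)).
  have [nt _] := is_frac_ok wb => pa.
  have nst : ~ fr_ideal x (u * (1 * (s * t))).
    by rewrite fmul1; do 2!apply: fr_idealM => //.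
  by apply: nst; rewrite -e fmulr1; apply: prime_mulr => //; apply: prime_mul.
have ok : fr_ok g x s a.
  split=> //; case: hs => [a0|->]; last by right.
  by case: na; rewrite a0; apply: prime0.
exists (mk_frac ok).
apply: (is_frac_inj (a := a * s) (s := s * a)); first exact: is_fracM (is_frac_mk ok).
apply/(is_fracE _ _ (is_frac_mk (fr_ok1 g x))); split.
  exact: fr_okM (is_frac_ok za) ok.
by exists 1; [apply: prime1 | rewrite !fmul1 fmulC fmulr1].
Qed.

Lemma frac_not_unit (x : fr_pt D) (z : fr_stalk g x) a s :
  is_frac z a s -> fr_ideal x a <-> ~ is_funit z.
Proof.
move=> za; rewrite (frac_unit za); split; first by move=> pa [].
exact: contrapT.
Qed.

Lemma fr_stalk_neq0 (x : fr_pt D) : ~ is_funit (0 : fr_stalk g x).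
Proof.
apply/(frac_not_unit (is_frac_mk (fr_ok0 g x))); exact: prime0 (fr_prime x).
Qed.

Lemma fr_op_D (f : A) : fr_op [set q : fr_pt D | ~ fr_ideal q f].
Proof.
exists (fun a => a = f); apply/seteqP; split=> q /=; first by exists f.
by case=> _ ->.
Qed.

End FractionUnits.

Section SpecMap.
Variables (A B : F1ring) (f : A -> B) (hf : is_F1hom f).

Lemma Spec_map_subproof (q : Spec B) :
  prime_ideal (fun a => fr_ideal q (f a)) /\ True.
Proof.
have [f1 f0 fM] := hf; have pq := fr_prime q; split=> //; split.
- by rewrite f0; apply: prime0.
- by move=> a b; rewrite fM; apply: prime_mul.
- by rewrite f1; apply: prime1.
- by move=> a b; rewrite fM; apply: Defs.primeP.
Qed.

Definition Spec_map_fun (q : Spec B) : Spec A :=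
  exist _ (fun a => fr_ideal q (f a)) (Spec_map_subproof q).

(** Quantifies over all fractions representing z, so that choice yields a map whose value is known
    on each of them. *)
Lemma Spec_map_pull_ex (q : Spec B) (z : stalk (Spec_map_fun q)) :
  exists w : stalk q,
    forall a s, is_frac z a s -> is_frac w (f a) (f s).
Proof.
have [f1 f0 fM] := hf; have [a [s za]] := is_frac_ex z.
have [ns _] := is_frac_ok za.
have ok b t (zb : is_frac z b t) : fr_ok (triv_grading B) q (f b) (f t).
  by split; [case: (is_frac_ok zb) | right].
exists (mk_frac (ok _ _ za)) => b t zb.
apply/(is_fracE _ _ (is_frac_mk _)); split; first exact: ok.
have [_ [u nu e]] := (is_fracE _ _ za).1 zb; exists (f u) => //.
by rewrite -!fM e.
Qed.

Definition Spec_map_pull (q : Spec B) (z : stalk (Spec_map_fun q)) : stalk q :=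
  proj1_sig (cid (Spec_map_pull_ex z)).

Lemma Spec_map_pullE (q : Spec B) (z : stalk (Spec_map_fun q)) a s :
  is_frac z a s -> is_frac (Spec_map_pull z) (f a) (f s).
Proof. by rewrite /Spec_map_pull; case: cid => w /= h /h. Qed.

Program Definition Spec_map : mor (Spec B) (Spec A) :=
  @Mor (Spec B) (Spec A) Spec_map_fun Spec_map_pull _ _ _ _.
Next Obligation.
move=> U [J ->]; exists (fun b => exists2 a, J a & b = f a).
apply/seteqP; split=> q /=; first by case=> a Ja na; exists (f a) => //; exists a.
by case=> _ [a Ja ->] na; exists a.
Qed.
Next Obligation.
have [f1 f0 fM] := hf; move=> q; split=> [||y z].
- apply: (is_frac_inj (a := 1) (s := 1)); last exact: is_frac_mk.
  have := Spec_map_pullE (is_frac_mk (fr_ok1 (triv_grading A) (Spec_map_fun q))).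
  by rewrite f1.
- apply: (is_frac_inj (a := 0) (s := 1)); last exact: is_frac_mk.
  have := Spec_map_pullE (is_frac_mk (fr_ok0 (triv_grading A) (Spec_map_fun q))).
  by rewrite f1 f0.
- have [a [s ya]] := is_frac_ex y; have [b [t zb]] := is_frac_ex z.
  have /= h := Spec_map_pullE (is_fracM ya zb).
  apply: is_frac_inj h _.
  by rewrite !fM; apply: is_fracM; apply: Spec_map_pullE.
Qed.
Next Obligation.
move=> q z; have [a [s za]] := is_frac_ex z.
by rewrite (frac_unit (Spec_map_pullE za)) (frac_unit za).
Qed.
Next Obligation.
move=> U s oU sU q /sU[V [oV Vq VU [a [b h]]]].
exists (Spec_map_fun @^-1` V); split=> //.
- exact: Spec_map_obligation_1.
- by move=> r /VU.
- by exists (f a), (f b) => r /h /Spec_map_pullE.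
Qed.

(** From here on f is a localization of A at S, described by its properties instead of being
    constructed. [S_op] is a genuine restriction: the spectrum of a localization need not be
    open. *)
Variable S : A -> Prop.
Hypothesis S1 : S 1.
Hypothesis SM : forall s t, S s -> S t -> S (s * t).
Hypothesis S_unit : forall s, S s -> is_funit (f s).
Hypothesis S_frac : forall b, exists a s, S s /\ b * f s = f a.
Hypothesis S_inj : forall a b, f a = f b -> exists2 u, S u & u * a = u * b.
Hypothesis S_op : op [set q : Spec A | forall s, S s -> ~ fr_ideal q s].

Section LiftPrime.
Variables (q : Spec A) (Sq : forall s, S s -> ~ fr_ideal q s).

(** The extension of q to B. By [loc_liftE] any one fraction representing b decides membership. *)
Definition loc_lift (b : B) : Prop :=
  exists a s, [/\ S s, b * f s = f a & fr_ideal q a].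

Lemma loc_liftE a s b : S s -> b * f s = f a -> loc_lift b <-> fr_ideal q a.
Proof.
have [f1 f0 fM] := hf; have pq := fr_prime q.
move=> Ss e; split=> [|qa]; last by exists a, s.
move=> [a' [s' [Ss' e' qa']]].
have [] := @S_inj (a * s') (a' * s).
  by rewrite !fM -e -e' -!fmulA [f s' * _]fmulC.
move=> u Su h; have : fr_ideal q (u * (a * s')).
  by rewrite h; apply: prime_mulr => //; apply: prime_mul.
by move=> /(Defs.primeP pq)[/(Sq Su)//|/(Defs.primeP pq)[//|/(Sq Ss')]].
Qed.

Lemma loc_lift_prime : prime_ideal loc_lift /\ True.
Proof.
have [f1 f0 fM] := hf; have pq := fr_prime q.
have mulE b c a s d t : b * f s = f a -> c * f t = f d ->
    (b * c) * f (s * t) = f (a * d).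
  by move=> h k; rewrite !fM -h -k fmulACA.
split=> //; split.
- by exists 0, 1; split=> //; [rewrite fmul0 f0 | apply: prime0].
- move=> b c [a [s [Ss e qa]]]; have [d [t [St h]]] := S_frac c.
  by exists (a * d), (s * t); split; [exact: SM|exact: mulE|exact: prime_mul].
- by rewrite (loc_liftE (a := 1) S1) ?fmul1 //; apply: prime1.
- move=> b c; have [a [s [Ss e]]] := S_frac b; have [d [t [St h]]] := S_frac c.
  rewrite (loc_liftE (SM Ss St) (mulE _ _ _ _ _ _ e h)).
  by rewrite (loc_liftE Ss e) (loc_liftE St h); apply: Defs.primeP.
Qed.

Lemma loc_liftK : Spec_map_fun (exist _ loc_lift loc_lift_prime) = q.
Proof.
have [f1 f0 fM] := hf; apply: fr_pt_eq => a /=.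
by apply: (loc_liftE S1); rewrite f1 fmulr1.
Qed.

End LiftPrime.

Lemma Spec_map_range :
  range Spec_map = [set q | forall s, S s -> ~ fr_ideal q s].
Proof.
apply/seteqP; split=> q /=.
  by case=> r _ <- s /S_unit u; apply: (prime_unit (fr_prime r)).
by move=> Sq; rewrite -(loc_liftK Sq); eexists.
Qed.

Lemma loc_primeE (q : Spec B) a s b : S s -> b * f s = f a ->
  fr_ideal q b <-> fr_ideal q (f a).
Proof.
move=> /S_unit us <-; have pq := fr_prime q; split; first exact: prime_mul.
by move=> /(Defs.primeP pq)[//|/(prime_unit pq us)].
Qed.

Lemma Spec_map_open : open_immersion Spec_map.
Proof.
have [f1 f0 fM] := hf; apply: open_immersion_intro.
- move=> q r /= e; apply: fr_pt_eq => b; have [a [s [Ss h]]] := S_frac b.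
  rewrite (loc_primeE q Ss h) (loc_primeE r Ss h).
  by have -> : fr_ideal q (f a) = fr_ideal (Spec_map_fun q) a by []; rewrite e.
(* Up to units, an element of J is its numerator, so the image of V is cut out of the open image of
   [Spec_map] by the numerators of J. *)
- move=> V [J VE]; rewrite (_ : _ @` _ = range Spec_map `&` [set q |
    exists2 a, (exists b s, [/\ J b, S s & b * f s = f a]) & ~ fr_ideal q a]).
    apply: opI; first by rewrite Spec_map_range.
    by exists (fun a => exists b s, [/\ J b, S s & b * f s = f a]).
  apply/seteqP; split=> q.
    case=> r; rewrite VE => -[b Jb nb] <-; split; first by exists r.
    have [a [s [Ss h]]] := S_frac b; exists a; first by exists b, s.
    by rewrite /= -(loc_primeE r Ss h).
  case=> -[r _ <-] [a [b [s [Jb Ss h]]] na]; exists r => //.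
  by rewrite VE; exists b => //; rewrite (loc_primeE r Ss h).
- move=> q z; have [b [t zb]] := is_frac_ex z; have pq := fr_prime q.
  have [a [s [Ss e]]] := S_frac b; have [a' [s' [Ss' e']]] := S_frac t.
  have [nt _] := is_frac_ok zb.
  have ok : fr_ok (triv_grading A) (Spec_map_fun q) (a * s') (a' * s).
    split; last by right.
    rewrite /= fM; apply: fr_idealM.
      by rewrite -(loc_primeE q Ss' e').
    exact: prime_unit (S_unit Ss).
  exists (mk_frac ok); apply: is_frac_inj (Spec_map_pullE (is_frac_mk ok)) _.
  apply/(is_fracE _ _ zb); split.
    by split; [case: ok | right].
  exists 1; first exact: prime1.
  rewrite !fmul1 !fM -e -e' -!fmulA; congr (_ * _).
  by rewrite [LHS]fmulC [f s' * _]fmulC -fmulA.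
- move=> q y z; have pq := fr_prime q.
  have [a [s ya]] := is_frac_ex y; have [b [t zb]] := is_frac_ex z.
  move=> /= e; have h := Spec_map_pullE ya; rewrite e in h.
  have [_ [u nu eu]] := (is_fracE _ _ h).1 (Spec_map_pullE zb).
  apply: (is_frac_inj _ zb); apply/(is_fracE _ _ ya).
  split; first exact: is_frac_ok zb.
  have [c [w [Sw ew]]] := S_frac u.
  have [|v Sv ev] := @S_inj (c * (a * t)) (c * (b * s)).
    by rewrite !fM -ew [u * _]fmulC -!fmulA eu.
  exists (v * c); last by rewrite -!fmulA.
  rewrite /= fM; apply: fr_idealM; first exact: prime_unit (S_unit Sv).
  by rewrite -(loc_primeE q Sw ew).
Qed.

End SpecMap.

(** * Finite type *)

Lemma fin_gen_fin (A : F1ring) (I : finType) (x : I -> A) :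
    (forall P : A -> Prop, P 0 -> P 1 -> (forall i a, P a -> P (x i * a)) ->
       forall a, P a) ->
  fin_gen A.
Proof.
move=> h; exists #|I|, (fun k => x (enum_val k)) => P P0 P1 PM; apply: h => // i.
by have := PM (enum_rank i); rewrite enum_rankK.
Qed.

Section AffineNeighbourhood.
Variables (A : F1ring) (p : Spec A).

Lemma fr_ok_triv (x : Spec A) a s :
  ~ fr_ideal x s -> fr_ok (triv_grading A) x a s.
Proof. by split=> //; right. Qed.

Definition to_stalk (a : A) : stalk p :=
  mk_frac (fr_ok_triv a (prime1 (fr_prime p))).

Lemma to_stalkE a : is_frac (to_stalk a) a 1.
Proof. exact: is_frac_mk. Qed.

Lemma to_stalk_hom : is_F1hom to_stalk.
Proof.
split=> [||a b]; first by apply: is_frac_inj (to_stalkE 1) (is_frac_mk _).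
  by apply: is_frac_inj (to_stalkE 0) (is_frac_mk _).
apply: is_frac_inj (to_stalkE _) _.
by have := is_fracM (to_stalkE a) (to_stalkE b); rewrite fmul1.
Qed.

Lemma to_stalk_unit s : ~ fr_ideal p s -> is_funit (to_stalk s).
Proof. by move=> ns; apply/(frac_unit (to_stalkE s)). Qed.

Lemma to_stalk_frac (z : stalk p) :
  exists a s, ~ fr_ideal p s /\ z * to_stalk s = to_stalk a.
Proof.
have [a [s za]] := is_frac_ex z; have [ns _] := is_frac_ok za.
exists a, s; split=> //; have h := is_fracM za (to_stalkE s).
apply: is_frac_inj h _; apply/(is_fracE _ _ (to_stalkE a)); split.
  by apply: fr_ok_triv; rewrite fmulr1.
by exists 1; [apply: prime1 (fr_prime p) | rewrite !fmul1 !fmulr1].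
Qed.

Lemma to_stalk_inj a b :
  to_stalk a = to_stalk b -> exists2 u, ~ fr_ideal p u & u * a = u * b.
Proof.
move=> e; have := to_stalkE a; rewrite e => h.
have [_ [u nu eu]] := (is_fracE _ _ h).1 (to_stalkE b).
by exists u => //; move: eu; rewrite !fmulr1.
Qed.

(** A product lies outside a prime only if its factors do, so a denominator is a product of
    generators outside p. Hence the images of the generators of A and the inverses of those outside
    p suffice; for generators inside p, [inv] takes the default value 1. *)
Lemma stalk_fin_gen : fin_gen A -> fin_gen (stalk p).
Proof.
move=> [n [x gx]]; have [t1 t0 tM] := to_stalk_hom.
pose inv (s : A) : stalk p := match pselect (fr_ideal p s) with
  | left _ => 1
  | right ns => mk_frac (fr_ok_triv 1 ns) end.
have invE s : ~ fr_ideal p s -> is_frac (inv s) 1 s.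
  by rewrite /inv; case: pselect => [//|ns] _; exact: is_frac_mk.
apply: (@fin_gen_fin _ ('I_n + 'I_n)%type (fun i => match i with
  | inl k => to_stalk (x k) | inr k => inv (x k) end)) => P P0 P1 PM.
have num a : forall z, P z -> P (to_stalk a * z).
  elim/gx: a => [||i a IH] z Pz; first by rewrite t0 fmul0.
    by rewrite t1 fmul1.
  by rewrite tM -fmulA; apply: (PM (inl i)); apply: IH.
have den s : ~ fr_ideal p s -> forall z (w : stalk p), is_frac w 1 s -> P z -> P (w * z).
  elim/gx: s => [||i a IH] ns z w ws Pz; first by case: ns; apply: prime0 (fr_prime p).
    by rewrite (_ : w = 1) ?fmul1 //; apply: is_frac_inj ws (is_frac_mk _).
  have nx : ~ fr_ideal p (x i) by move=> h; apply: ns; exact: (prime_mul (fr_prime p) _ h).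
  have na : ~ fr_ideal p a by move=> h; apply: ns; exact: (prime_mulr _ (fr_prime p) h).
  have h : is_frac (inv (x i) * inv a) 1 (x i * a).
    by have := is_fracM (invE _ nx) (invE _ na); rewrite fmul1.
  rewrite (is_frac_inj ws h) -fmulA.
  by apply: (PM (inr i)); apply: IH (invE _ na) Pz.
move=> z; have [a [s za]] := is_frac_ex z; have [ns _] := is_frac_ok za.
have h : is_frac (to_stalk a * inv s) a s.
  by have := is_fracM (to_stalkE a) (invE _ ns); rewrite fmul1 fmulr1.
rewrite (is_frac_inj za h).
apply: num; rewrite -[inv s]fmulr1; apply: den (invE _ ns) P1 => //.
Qed.

(** An element outside p is a product of generators outside p, so finitely many basic open sets cut
    out the generizations of p. *)
Lemma generization_op : fin_gen A ->
  op [set q : Spec A | forall s, ~ fr_ideal p s -> ~ fr_ideal q s].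
Proof.
move=> [n [x gx]]; have pp := fr_prime p.
pose V (i : 'I_n) : set (Spec A) :=
  [set q | ~ fr_ideal p (x i) -> ~ fr_ideal q (x i)].
rewrite (_ : mkset _ = [set q | forall i, V i q]).
  apply: op_cap => i; have [px|nx] := pselect (fr_ideal p (x i)).
    rewrite (_ : V i = setT); first exact: opT.
    by apply/seteqP; split=> // q _ /(_ px).
  rewrite (_ : V i = [set q | ~ fr_ideal q (x i)]); first exact: fr_op_D.
  by apply/seteqP; split=> q /= h; [apply: h | move=> _].
apply/seteqP; split=> q /=; first by move=> h i; apply: h.
move=> Vq; elim/gx => [[]||i a IH npa].
- exact: prime0.
- by move=> _; apply: prime1 (fr_prime q).
apply: fr_idealM.
  by apply: Vq => px; apply: npa; apply: prime_mul.
by apply: IH => pa; apply: npa; apply: prime_mulr.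
Qed.

(** An open set containing p contains all generizations of p, and these form the spectrum of the
    stalk, which therefore works for every U. *)
Lemma affine_nbhd U : fin_gen A -> op U -> U p ->
  exists B (j : mor (Spec B) (Spec A)),
    [/\ fin_gen B, open_immersion j, range j p & range j `<=` U].
Proof.
move=> fA oU Up; pose S s := ~ fr_ideal p s.
have S1 : S 1 by apply: prime1 (fr_prime p).
have SM s t : S s -> S t -> S (s * t) by apply: fr_idealM.
have rE := Spec_map_range to_stalk_hom S1 SM to_stalk_unit to_stalk_frac
  to_stalk_inj.
exists (stalk p), (Spec_map to_stalk_hom); split.
- exact: stalk_fin_gen.
- exact: (Spec_map_open _ S1 SM (@to_stalk_unit) to_stalk_frac (@to_stalk_inj)
    (generization_op fA)).
- by rewrite rE.
- move=> q; rewrite rE => h; case: oU Up => J ->.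
  by case=> f Jf nf; exists f => //; apply: h.
Qed.

End AffineNeighbourhood.

Definition affine_chart (X : monoidalSpace) (U : set X) (x : X) : Prop :=
  exists B (j : mor (Spec B) X),
    [/\ fin_gen B, open_immersion j, range j x & range j `<=` U].

Lemma finite_type_chart (X : monoidalSpace) (U : set X) x :
  finite_type X -> op U -> U x -> affine_chart U x.
Proof.
move=> [n [A [j [hj cov]]]] oU Ux; have [k [p _ e]] := cov x.
have [fA oj] := hj k.
have Up : (j k @^-1` U) p by rewrite /= e.
have [B [i [fB oi [q _ iq] iU]]] := affine_nbhd fA (mor_cont (j k) oU) Up.
exists B, (Defs.comp (j k) i); split=> //.
- exact: open_immersion_comp.
- by exists q => //=; rewrite iq.
- by move=> _ [r _ <-] /=; apply: iU; exists r.
Qed.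

(** The injective labelling expresses that X has finitely many points, so one chart per point gives
    a finite cover. *)
Lemma finite_type_of_charts (X : monoidalSpace) (I : finType) (t : X -> I) :
  injective t -> (forall x : X, affine_chart [set: X] x) -> finite_type X.
Proof.
move=> it h; pose J : finType := {i : I | `[< exists x, t x = i >]}.
pose pick (j : J) : X := proj1_sig (cid (asboolW (valP j))).
have pickE x : exists j, pick j = x.
  have hx : `[< exists y, t y = t x >] by apply/asboolP; exists x.
  exists (exist _ (t x) hx); rewrite /pick; case: cid => y /= /it //.
pose chart (k : 'I_#|J|) := cid (h (pick (enum_val k))).
exists #|J|, (fun k => projT1 (chart k)), (fun k => projT1 (cid (projT2 (chart k)))).
split=> [k|x]; first by case: cid => /= j [].
have [j jx] := pickE x; exists (enum_rank j).
case: cid => i /= [_ _ [y _ iy] _]; exists y => //.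
by rewrite iy enum_rankK.
Qed.

(** Needed to give the complement of a closed point a class in [K0]. *)
Lemma osub_finite_type (X : monoidalSpace) (U : set X) (oU : op U)
    (I : finType) (t : X -> I) :
  injective t -> finite_type X -> finite_type (osub oU).
Proof.
move=> it fX; apply: (@finite_type_of_charts (osub oU) I (fun y => t (proj1_sig y))).
  by move=> [x Ux] [y Uy] /= /it e; apply: eq_exist.
move=> [x Ux]; have [B [j [fB oj [q _ jq] jU]]] := finite_type_chart fX oU Ux.
have jU' z : U (j z) by apply: jU; exists z.
exists B, (corestr oU jU'); split=> //; first exact: corestr_open.
by exists q => //=; apply: eq_exist.
Qed.

(** * Groups with zero *)

Definition group_with_zero (K : F1ring) : Prop :=
  ~ is_funit (0 : K) /\ forall a : K, a <> 0 -> is_funit a.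

Lemma gw0P (K : F1ring) (a : K) :
  group_with_zero K -> ~ is_funit a -> a = 0.
Proof. by move=> [_ h] na; apply: contrapT => /h. Qed.

Section SpecGroup.
Variables (K : F1ring) (gK : group_with_zero K).

Lemma gw0_prime (q : Spec K) a : fr_ideal q a <-> a = 0.
Proof.
split=> [qa|->]; last exact: prime0 (fr_prime q).
by apply: gw0P => // /(prime_unit (fr_prime q)).
Qed.

(** [finite_type] asks for charts that are spectra, so the one-point space is covered by Spec K,
    whose only prime is {0}. *)
Program Definition Spec_to_ptS : mor (Spec K) (ptS K) :=
  @Mor (Spec K) (ptS K) (fun=> tt) (fun q => to_stalk q) _ _ _ _.
Next Obligation.
move=> U _; have [Ut|nU] := pselect (U tt).
  by rewrite (_ : _ @^-1` _ = setT); [exact: opT | apply/seteqP; split].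
by rewrite (_ : _ @^-1` _ = set0); [exact: op0 | apply/seteqP; split].
Qed.
Next Obligation. by move=> q; apply: to_stalk_hom. Qed.
Next Obligation.
move=> q a /(frac_unit (to_stalkE q a)) na; apply: gK.2 => a0.
by apply: na; apply/gw0_prime.
Qed.
Next Obligation.
move=> U s _ _ q Uq; exists setT; split=> //; first exact: fr_opT.
by exists (s tt), 1 => y _; apply: to_stalkE.
Qed.

Lemma Spec_to_ptS_open : open_immersion Spec_to_ptS.
Proof.
apply: open_immersion_intro => //.
- by move=> q r _; apply: fr_pt_eq => a; rewrite !gw0_prime.
- move=> q z; have [a [s [ns e]]] := to_stalk_frac z.
  have [|v sv] := gK.2 s; first by move=> s0; apply: ns; apply/gw0_prime.
  exists (a * v); have [t1 t0 tM] := to_stalk_hom q => /=.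
  by rewrite tM -e -fmulA -tM sv t1 fmulr1.
- move=> q a b /to_stalk_inj[u nu]; apply: funit_cancel; apply: gK.2 => u0.
  by apply: nu; apply/gw0_prime.
Qed.

Lemma ptS_finite_type : fin_gen K -> finite_type (ptS K).
Proof.
move=> fK; exists 1%N, (fun=> K), (fun=> Spec_to_ptS); split.
  by move=> _; split=> //; exact: Spec_to_ptS_open.
have P0 : prime_ideal (fun a : K => a = 0) /\ True.
  split=> //; split=> //.
  - by move=> a b ->; rewrite fmul0.
  - by move=> e; apply: gK.1; exists 0; rewrite fmul0.
  - move=> a b ab0; have [?|/gK.2 ua] := pselect (a = 0); first by left.
    by right; apply: (funit_cancel ua); rewrite fmulr0.
by move=> []; exists ord0, (exist _ (fun a : K => a = 0) P0).
Qed.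

End SpecGroup.

Lemma ptS_mor_eq (Z : monoidalSpace) (K : F1ring) (u v : mor Z (ptS K)) :
  (forall z a, pull u z a = pull v z a) -> u = v.
Proof.
case: u => f p fc ph pl ps; case: v => g q gc qh ql qs /= e.
have fg : f = g by apply/funext => z; case: (f z); case: (g z).
subst g; have pq : p = q by apply: functional_extensionality_dep => z; apply/funext => a.
subst q; congr Mor; exact: Prop_irrelevance.
Qed.

(** The retraction r supplies locality: if a g is a unit, so is g = r (a g). *)
Program Definition ptS_mor (G P : F1ring) (a : G -> P) (r : P -> G)
    (ha : is_F1hom a) (hr : is_F1hom r) (ra : cancel a r) :
    mor (ptS P) (ptS G) :=
  @Mor (ptS P) (ptS G) (fun x => x) (fun _ => a) _ _ _ _.
Next Obligation. by []. Qed.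
Next Obligation. by move=> *. Qed.
Next Obligation. by move=> G P a r ha hr ra x g /(funit_hom hr); rewrite ra. Qed.
Next Obligation. by []. Qed.

(* P is the coproduct of G and H: its nonzero elements are the products of
   those of G and of H. *)
Record smash (G H P : F1ring) (a : G -> P) (b : H -> P) (ra : P -> G)
    (rb : P -> H) : Prop := {
  smash_a : is_F1hom a; smash_b : is_F1hom b;
  smash_ra : is_F1hom ra; smash_rb : is_F1hom rb;
  smash_aK : cancel a ra; smash_bK : cancel b rb;
  smash_rba : forall g, g <> 0 -> rb (a g) = 1;
  smash_rab : forall h, h <> 0 -> ra (b h) = 1;
  smashE : forall p, p = a (ra p) * b (rb p) }.

Section Smash.
Variables (G H P : F1ring) (a : G -> P) (b : H -> P) (ra : P -> G) (rb : P -> H).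
Hypothesis sm : smash a b ra rb.

Lemma smash_fin_gen : fin_gen G -> fin_gen H -> fin_gen P.
Proof.
move=> [n [x gx]] [m [y gy]]; have [a1 a0 aM] := smash_a sm.
have [b1 b0 bM] := smash_b sm.
apply: (@fin_gen_fin _ ('I_n + 'I_m)%type (fun i => match i with
  | inl k => a (x k) | inr k => b (y k) end)) => Q Q0 Q1 QM p.
rewrite (smashE sm p); elim/gx: (ra p) => [||i g IH].
- by rewrite a0 fmul0.
- rewrite a1 fmul1; elim/gy: (rb p) => [||i h IH]; rewrite ?b0 ?b1 //.
  by rewrite bM; apply: (QM (inr i)).
- by rewrite aM -fmulA; apply: (QM (inl i)).
Qed.

Definition smash_p : mor (ptS P) (ptS G) :=
  ptS_mor (smash_a sm) (smash_ra sm) (smash_aK sm).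
Definition smash_q : mor (ptS P) (ptS H) :=
  ptS_mor (smash_b sm) (smash_rb sm) (smash_bK sm).

Section SmashMor.
Variables (Z : monoidalSpace) (f : mor Z (ptS G)) (h : mor Z (ptS H)).

Program Definition smash_mor : mor Z (ptS P) :=
  @Mor Z (ptS P) (fun=> tt) (fun z p => pull f z (ra p) * pull h z (rb p))
    _ _ _ _.
Next Obligation.
move=> U oU; rewrite (_ : _ @^-1` U = f @^-1` U); first exact: mor_cont.
by apply/seteqP; split=> z /=; case: (f z).
Qed.
Next Obligation.
have [ra1 ra0 raM] := smash_ra sm; have [rb1 rb0 rbM] := smash_rb sm.
move=> z; have [f1 f0 fM] := pull_hom f z; have [h1 h0 hM] := pull_hom h z.
split=> [||x y]; first by rewrite ra1 rb1 f1 h1 fmul1.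
  by rewrite ra0 f0 fmul0.
by rewrite raM rbM fM hM fmulACA.
Qed.
Next Obligation.
move=> z p /funitM[/pull_local ura /pull_local urb]; rewrite (smashE sm p).
by apply/funitM; split; [apply: funit_hom (smash_a sm) ura|apply: funit_hom (smash_b sm) urb].
Qed.
Next Obligation.
move=> U s oU _.
(* The preimage of U under any map to a one-point space is everything or nothing, and the same for f
   and h; so the two pulled back sections live over the same open set and can be multiplied. *)
have UE (K : F1ring) (k : mor Z (ptS K)) : k @^-1` U = (fun=> U tt).
  by apply/funext => z; rewrite /preimage /=; case: (k z).
have fs := pull_sec f (U := U) (s := fun=> ra (s tt)) oU I.
have hs := pull_sec h (U := U) (s := fun=> rb (s tt)) oU I.
have oU' := mor_cont f (U := U) oU; rewrite UE in oU'.
by rewrite UE in fs; rewrite UE in hs; apply: secM fs hs.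
Qed.

End SmashMor.

Lemma smash_product : is_product smash_p smash_q.
Proof.
move=> Z f h _; exists (smash_mor f h); split.
  have [a1 a0 aM] := smash_a sm; have [b1 b0 bM] := smash_b sm.
  split; apply: ptS_mor_eq => z x /=.
    have [f1 f0 fM] := pull_hom f z; have [h1 h0 hM] := pull_hom h z.
    (* Zero is treated apart, since [rb] sends [a 0] to 0 and not to 1. *)
    rewrite (smash_aK sm); have [->|x0] := pselect (x = 0).
      by rewrite f0 fmul0.
    by rewrite (smash_rba sm) // h1 fmulr1.
  have [f1 f0 fM] := pull_hom f z; have [h1 h0 hM] := pull_hom h z.
  rewrite (smash_bK sm); have [->|x0] := pselect (x = 0).
    by rewrite h0 fmulr0.
  by rewrite (smash_rab sm) // f1 fmul1.
move=> u [uf uh]; apply: ptS_mor_eq => z p /=.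
have [u1 u0 uM] := pull_hom u z; rewrite [in RHS](smashE sm p) uM.
congr (_ * _); first by rewrite -uf.
by rewrite -uh.
Qed.

End Smash.

(** An index type with m elements. Nested options let Z^(m+1) split as Z^m times Z by pattern
    matching, and [Set] keeps the universe low, as for [F1poly]. *)
Fixpoint zidx (m : nat) : Set := if m is m'.+1 then option (zidx m') else Empty_set.

Definition zmul (J : Set) (a b : option (J -> int)) : option (J -> int) :=
  match a, b with
  | Some f, Some h => Some (fun i => f i + h i)%R
  | _, _ => None
  end.

(* The group Z^m with a zero added. *)
Program Definition Z0 (m : nat) : F1ring :=
  @MkF1ring (option (zidx m -> int)) (Some (fun=> 0%R)) None (@zmul (zidx m))
    _ _ _ _.
Next Obligation.
by move=> m [f|] [h|] [k|] //=; congr Some; apply/funext => i; rewrite addrA.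
Qed.
Next Obligation.
by move=> m [f|] [h|] //=; congr Some; apply/funext => i; rewrite addrC.
Qed.
Next Obligation.
by move=> m [f|] //=; congr Some; apply/funext => i; rewrite add0r.
Qed.
Next Obligation. by []. Qed.

Lemma Z0_gw0 m : group_with_zero (Z0 m).
Proof.
split=> [[[f|] //]|[f|//] _]; exists (Some (fun i => - f i)%R).
by congr Some; apply/funext => i; rewrite subrr.
Qed.

Section Z0smash.
Variable m : nat.

Definition Z0a (x : Z0 m) : Z0 m.+1 :=
  if x is Some f then Some (fun i => if i is Some j then f j else 0%R) else None.
Definition Z0b (x : Z0 1) : Z0 m.+1 :=
  if x is Some f then Some (fun i => if i is Some j then 0%R else f None) else None.
Definition Z0ra (x : Z0 m.+1) : Z0 m :=
  if x is Some f then Some (fun j => f (Some j)) else None.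
Definition Z0rb (x : Z0 m.+1) : Z0 1 :=
  if x is Some f then Some (fun=> f None) else None.

Lemma zidx1 (i : zidx 1) : i = None. Proof. by case: i => [[]|]. Qed.

Lemma Z0_smash : smash Z0a Z0b Z0ra Z0rb.
Proof.
split.
- split=> // [|[f|] [h|] //=]; congr Some; apply/funext=> -[i|] //=.
- split=> // [|[f|] [h|] //=]; congr Some; apply/funext=> -[i|] //=.
- by split=> // -[f|] [h|].
- by split=> // -[f|] [h|].
- by move=> [f|].
- by move=> [f|] //=; congr Some; apply/funext=> i; rewrite (zidx1 i).
- by move=> [f|].
- by move=> [f|].
- move=> [f|] //=; congr Some; apply/funext=> -[i|] /=; first by rewrite addr0.
  by rewrite add0r.
Qed.

End Z0smash.

Lemma Z0_fin_gen m : fin_gen (Z0 m).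
Proof.
have fg0 : fin_gen (Z0 0).
  exists 0%N, (fun=> 1) => P P0 P1 _ [f|//]; move: P1; congr P.
  by congr Some; apply/funext => -[].
have fg1 : fin_gen (Z0 1).
  pose c (n : int) : Z0 1 := Some (fun=> n).
  have cM x y : c x * c y = c (x + y)%R by [].
  apply: (@fin_gen_fin _ bool (fun s => c (if s then 1%R else (-1)%R))).
  move=> P P0 P1 PM [f|//].
  have -> : Some f = c (f None) by congr Some; apply/funext => i; rewrite (zidx1 i).
  elim: (f None) => [//|n /(PM true)|n /(PM false)].
    by rewrite cM -add1n PoszD.
  by rewrite cM -opprD -PoszD.
elim: m => [//|m IH]; exact: smash_fin_gen (Z0_smash m) IH fg1.
Qed.

(** The split torus G_m^m over F_1, which has a single point. *)
Definition Pt (m : nat) : schFT :=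
  SchFT (ptS_finite_type (Z0_gw0 m) (Z0_fin_gen m)).

Lemma classKM (P X Y : schFT) (p : mor P X) (q : mor P Y) :
  is_product p q -> (classK X * classK Y)%R = classK P.
Proof.
by move=> h; rewrite -[LHS]/(K0mul _ _) kpiM; apply/kpiP; apply: keq_prod h.
Qed.

Lemma classK_cut (X Y U : schFT) (i : mor Y X) (j : mor U X) :
    closed_immersion i -> open_immersion j -> range j = ~` range i ->
  classK X = (classK U + classK Y)%R.
Proof.
move=> ci oj e; rewrite -[RHS]/(K0add _ _) kpiD; apply/kpiP.
exact: keq_cut ci oj e.
Qed.

Lemma Pt_S m : classK (Pt m.+1) = (classK (Pt m) * classK (Pt 1))%R.
Proof. by rewrite (@classKM (Pt m.+1) (Pt m) (Pt 1) _ _ (smash_product (Z0_smash m))). Qed.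

(** The empty scheme is its own closed subscheme and its own complement, so cutting gives [X] = [X]
    + [X]. *)
Lemma classK_empty (X : schFT) : (X -> False) -> classK X = 0%R.
Proof.
move=> X0; have oi := idm_open X; have [im oR _] := oi.
have nE : ~` range (idm X) = range (idm X) by apply/seteqP; split=> x; case: (X0 x).
have ci : closed_immersion (idm X) by split=> //; rewrite nE.
have /eqP := classK_cut ci oi (esym nE).
by rewrite -[X in X == _]addr0 (inj_eq (addrI _)) eq_sym => /eqP.
Qed.

(** * Stratified spaces *)

Lemma comp_idm (X Y : monoidalSpace) (f : mor X Y) : Defs.comp (idm Y) f = f.
Proof. by case: f => *; rewrite /Defs.comp /=; congr Mor; exact: Prop_irrelevance. Qed.

Lemma Z0_0E (a : Z0 0) : a = 0 \/ a = 1.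
Proof. by case: a => [f|]; [right; congr Some; apply/funext => -[]|left]. Qed.

Definition Z0_0map (K : F1ring) (a : Z0 0) : K := if a is Some _ then 1 else 0.

Program Definition Spec_to_Pt0 (A : F1ring) : mor (Spec A) (Pt 0) :=
  @Mor (Spec A) (Pt 0) (fun=> tt) (fun q => @Z0_0map (stalk q)) _ _ _ _.
Next Obligation.
move=> A U _; have [Ut|nU] := pselect (U tt).
  by rewrite (_ : _ @^-1` _ = setT); [exact: opT | apply/seteqP; split].
by rewrite (_ : _ @^-1` _ = set0); [exact: op0 | apply/seteqP; split].
Qed.
Next Obligation.
move=> A q; split=> [||a b]; [by []|by []|].
have [->|->] := Z0_0E a; first by rewrite fmul0 [RHS]fmul0.
by rewrite fmul1 [RHS]fmul1.
Qed.
Next Obligation.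
move=> A q a; have [->|->] := Z0_0E a; first by move=> /fr_stalk_neq0.
by move=> _; exists 1.
Qed.
Next Obligation.
move=> A U s _ _; have oV := @Spec_to_Pt0_obligation_1 A U; rewrite /Z0_0map /=.
by case: (s tt) => [f|]; [apply: (sec1 oV) | apply: (sec0 oV)].
Qed.

(** Two morphisms from Z to [Pt 0] always agree, so Spec F_1 is the product of itself with [Pt 0];
    the product relation then reads 1 * [Pt 0] = 1. *)
Lemma Pt0_1 : classK (Pt 0) = 1%R.
Proof.
rewrite -[LHS]mul1r; apply: (@classKM SpecF1 SpecF1 (Pt 0) (idm _) (Spec_to_Pt0 _)).
move=> Z f h _; exists f; split; last by move=> u [<- _]; rewrite comp_idm.
split; first exact: comp_idm.
apply: ptS_mor_eq => z a /=.
have [f1 f0 _] := pull_hom f z; have [h1 h0 _] := pull_hom h z.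
by have [->|->] := Z0_0E a; rewrite ?h1 ?h0.
Qed.

Lemma Pt_exp m : classK (Pt m) = (classK (Pt 1) ^+ m)%R.
Proof. by elim: m => [|m IH]; rewrite ?Pt0_1 // Pt_S IH exprSr. Qed.

(* A label for each point, with a rank such that the residue at a point is the
   split torus of that rank, and such that the points of least rank in a locally
   closed subset are closed in it. *)
Record stratified (X : monoidalSpace) (F : finType) (t : X -> F) (r : F -> nat) :
    Prop := {
  str_inj : injective t;
  str_res : forall x, exists f : stalk x -> Z0 (r (t x)), is_residue f;
  str_sep : forall x y, x <> y -> (r (t y) <= r (t x))%N ->
    exists V, [/\ op V, V x & ~ V y] }.

Section Stratified.
Variables (F : finType) (r : F -> nat).

Definition labels (X : monoidalSpace) (t : X -> F) (C : set X) : {set F} :=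
  [set f | `[< exists2 x, C x & t x = f >]]%SET.

Lemma labelsP (X : monoidalSpace) (t : X -> F) C f :
  reflect (exists2 x, C x & t x = f) (f \in labels t C).
Proof. by rewrite inE; apply: asboolP. Qed.

Lemma mem_labels (X : monoidalSpace) (t : X -> F) (C : set X) x :
  C x -> t x \in labels t C.
Proof. by move=> Cx; apply/labelsP; exists x. Qed.

Lemma osub_stratified (X : monoidalSpace) (t : X -> F) (U : set X) (oU : op U) :
  stratified t r -> @stratified (osub oU) F (fun y => t (proj1_sig y)) r.
Proof.
move=> [it res sep]; split.
- by move=> [x Ux] [y Uy] /it /= e; apply: eq_exist.
- by move=> [x Ux]; apply: res.
- move=> [x Ux] [y Uy] ne le; have [|V [oV Vx nVy]] := sep x y _ le.
    by move=> e; apply: ne; apply: eq_exist.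
  exists [set z | V (proj1_sig z)]; split=> //.
  exact: (mor_cont (osub_inc oU) oV).
Qed.

(** The residue at [i y] descends along the surjection [pull i y]: by [imm_ideal], distinct elements
    with the same image are sent to 0, and by locality what is sent to 0 is a non-unit, of residue
    0. *)
Lemma imm_stratified (Y X : monoidalSpace) (t : X -> F) (i : mor Y X) :
  immersion i -> stratified t r -> stratified (fun y => t (i y)) r.
Proof.
move=> im [it res sep]; split.
- by move=> x y /it /(imm_inj im).
- move=> y; have [f [fh fl fs fi]] := res (i y).
  have [p1 p0 pM] := pull_hom i y; have [f1 f0 fM] := fh.
  have gw := Z0_gw0 (r (t (i y))).
  have null a : pull i y a = 0 -> f a = 0.
    move=> pa0; apply: (gw0P gw) => /fl /(funit_hom (pull_hom i y)).
    rewrite pa0 -p0 => /pull_local /(funit_hom fh); rewrite f0; exact: gw.1.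
  pose g b := f (proj1_sig (cid (imm_surj im b))).
  have gE a : g (pull i y a) = f a.
    rewrite /g; case: cid => a' /= e; have [->//|n] := imm_ideal im e.
    by rewrite !null // -e.
  exists g; split.
  + split; first by rewrite -p1 gE.
      by rewrite -p0 gE.
    move=> b c; have [a <-] := imm_surj im b; have [d <-] := imm_surj im c.
    by rewrite -pM !gE.
  + move=> b; have [a <-] := imm_surj im b; rewrite gE => /fl.
    exact/funit_hom/pull_hom.
  + by move=> z; have [a <-] := fs z; exists (pull i y a).
  + move=> b c; have [a <-] := imm_surj im b; have [d <-] := imm_surj im c.
    by rewrite !gE => /fi[->|]; [left|right].
- move=> x y ne le; have [|V [oV Vx nVy]] := sep _ _ _ le.
    by move/(imm_inj im).
  by exists (i @^-1` V); split=> //; apply: mor_cont.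
Qed.

Lemma classK_stratified (Y : schFT) (t : Y -> F) : stratified t r ->
  classK Y = (\sum_(f in labels t setT) classK (Pt (r f)))%R.
Proof.
move En : #|labels t setT| => n; elim: n Y t En => [|n IH] Y t En st.
  rewrite (cards0_eq En) big_set0; apply: classK_empty => y.
  by have := mem_labels t (I : setT y); rewrite (cards0_eq En) inE.
have /card_gt0P[f0 f0in] : (0 < #|labels t setT|)%N by rewrite En.
case: (arg_minnP r f0in) => f /labelsP[y _ tyf] fmin.
have {fmin}ymin x : (r (t y) <= r (t x))%N by rewrite tyf; apply: fmin; apply: mem_labels.
have cl : op (~` [set y]).
  apply: open_of_nbhs => x /= xy.
  have [V [oV Vx nVy]] := str_sep st xy (ymin x).
  by exists V; split=> // z Vz /= zy; apply: nVy; rewrite -zy.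
have [g rg] := str_res st y.
pose U : schFT := SchFT (osub_finite_type cl (str_inj st) (sch_ft Y)).
rewrite (@classK_cut Y (Pt (r (t y))) U _ _ (pt_mor_closed rg cl)
  (osub_inc_open cl)); last first.
  by rewrite osub_inc_range; congr (~` _); apply/esym/pt_mor_range.
have LE : labels t setT = (t y |: labels (X := U) (fun z => t (proj1_sig z)) setT)%SET.
  apply/setP => h; apply/labelsP/setU1P.
    move=> [x _ <-]; have [->|xy] := pselect (x = y); first by left.
    by right; apply/labelsP; exists (exist _ x xy).
  by case=> [->|/labelsP[[x xy] _ <-]]; [exists y | exists x].
have nin : t y \notin labels (X := U) (fun z => t (proj1_sig z)) setT.
  by apply/labelsP => -[[x xy] _] /= /(str_inj st).
rewrite LE big_setU1 //= addrC; congr (_ + _)%R.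
apply: (IH U (fun z => t (proj1_sig z))); last exact: osub_stratified.
by move: En; rewrite LE cardsU1 nin add1n => -[].
Qed.

Variables (X : monoidalSpace) (t : X -> F).
Hypothesis st : stratified t r.

(** U avoids every other point of rank at most that of x, and Z is the closure of x. A point of
    larger rank has a neighbourhood missing x, hence is not in Z. *)
Lemma point_lclosed x :
  exists U Z : set X, [/\ op U, op (~` Z) & U `&` Z = [set x]].
Proof.
have nb f : exists V : set X, [/\ op V, V x & forall y, t y = f -> y <> x ->
    (r (t y) <= r (t x))%N -> ~ V y].
  have [[y [tyf yx le]]|h] := pselect (exists y, [/\ t y = f, y <> x &
      (r (t y) <= r (t x))%N]).
    have [V [oV Vx nVy]] := str_sep st (nesym yx) le.
    by exists V; split=> // z; rewrite -tyf => /(str_inj st) ->.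
  exists setT; split=> //; first exact: opT.
  by move=> y tyf yx le; case: h; exists y.
have [V hV] := choice nb.
exists [set y | forall f, V f y], (~` [set y | exists2 W, op W /\ ~ W x & W y]).
split; first by apply: op_cap => f; have [] := hV f.
  by rewrite setCK; apply: op_union => W [].
apply/seteqP; split=> y /=; last first.
  by move=> ->; split=> [f|[W []//]]; have [] := hV f.
move=> [Vy nW]; apply: contrapT => yx; have [le|lt] := leqP (r (t y)) (r (t x)).
  by have [_ _ h] := hV (t y); apply: (h y).
have [W [oW Wy nWx]] := str_sep st yx (ltnW lt).
by apply: nW; exists W.
Qed.

(** The points of C, each locally closed in X, already form a decomposition. *)
Lemma decomp_class_labels (C : set X) :
  decomp_class C (\sum_(f in labels t C) classK (Pt (r f)))%R.
Proof.
pose A := labels t C.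
have pts (k : 'I_#|A|) : exists x, C x /\ t x = enum_val k.
  by have /labelsP[x Cx tx] := enum_valP k; exists x.
have [x hx] := choice pts.
pose i k : mor (Pt (r (t (x k)))) X := pt_mor (proj2_sig (cid (str_res st (x k)))).
have xinj k l : x k = x l -> k = l.
  by move=> e; apply: enum_val_inj; rewrite -(hx k).2 -(hx l).2 e.
have iE k : range (i k) = [set x k] by apply: pt_mor_range.
exists #|A|, (fun k => Pt (r (t (x k)))), i; split.
- move=> k; have [U [Z [oU oZ e]]] := point_lclosed (x k).
  exact: pt_mor_immersion e.
- move=> k l kl; rewrite !iE; apply/seteqP; split=> y //= [->].
  by move/xinj.
- apply/seteqP; split=> y.
    move=> Cy; have ty := mem_labels t Cy; exists (enum_rank_in ty (t y)).
    rewrite iE /=; apply: (str_inj st); rewrite (hx _).2 enum_rankK_in //.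
  by case=> k; rewrite iE /= => ->; have [] := hx k.
- by rewrite big_enum_val; apply: eq_bigr => k _; rewrite (hx k).2.
Qed.

(** Disjoint pieces have disjoint label sets, because labels are injective; and each piece inherits
    the stratification along its immersion. *)
Lemma decomp_class_unique (C : set X) c : decomp_class C c ->
  c = (\sum_(f in labels t C) classK (Pt (r f)))%R.
Proof.
move=> [m [Y [i [im dis CE ->]]]].
pose B k := labels t (range (i k)).
have -> : labels t C = (\bigcup_(k < m) B k)%SET.
  apply/setP => f; apply/labelsP/bigcupP => [[x Cx <-]|[k _ /labelsP[x xk <-]]].
    move: Cx; rewrite CE => -[k ik]; exists k => //; exact: mem_labels.
  by exists x => //; rewrite CE; exists k.
rewrite partition_disjoint_bigcup => [|k l kl]; last first.
  rewrite -setI_eq0; apply/eqP/setP => f; rewrite !inE.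
  apply/negP => /andP[/asboolP[x xk <-] /asboolP[y yl /(str_inj st) yx]].
  have : (range (i k) `&` range (i l)) x by split=> //; rewrite -yx.
  by rewrite dis //; apply/eqP.
apply: eq_bigr => k _; rewrite (classK_stratified (imm_stratified (im k) st)).
apply: eq_bigl => f; apply/labelsP/labelsP.
  by case=> y _ <-; exists (i k y) => //; exists y.
by case=> _ [y _ <-] <-; exists y.
Qed.

Lemma constr_class_labels (C : set X) :
  constr_class C = (\sum_(f in labels t C) classK (Pt (r f)))%R.
Proof.
apply: xget_unique; first exact: decomp_class_labels.
by move=> c /decomp_class_unique.
Qed.

End Stratified.

(** * Points and residues of affine and projective spaces *)

Lemma Some_fun (I T : Type) (f h : I -> T) : Some f = Some h -> f =1 h.
Proof. by case=> ->. Qed.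

Section Exponents.
Variable n : nat.

Definition oi (k : 'I_n) : {i | (i < n)%N} := exist _ (k : nat) (ltn_ord k).
Definition mkexp (f : 'I_n -> nat) (i : {i | (i < n)%N}) : nat :=
  f (Ordinal (proj2_sig i)).

Lemma mkexpE f k : mkexp f (oi k) = f k.
Proof. by congr f; apply: val_inj. Qed.

Lemma exp_ext (f h : {i | (i < n)%N} -> nat) :
  (forall k, f (oi k) = h (oi k)) -> f = h.
Proof.
move=> e; apply/funext => -[i hi].
by rewrite (_ : exist _ i hi = oi (Ordinal hi)) //; apply: eq_exist.
Qed.

Lemma oi_eq (k l : 'I_n) : (proj1_sig (oi k) == l :> nat) = (k == l).
Proof. by []. Qed.

Lemma pdegE (f : {i | (i < n)%N} -> nat) :
  pdeg (Some f : F1poly n) = (\sum_k f (oi k))%N.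
Proof. by []. Qed.

Lemma F1var_dvd (f : {i | (i < n)%N} -> nat) k : (0 < f (oi k))%N ->
  exists2 h, (Some f : F1poly n) = F1var k * Some h
    & (pdeg (Some h : F1poly n) < pdeg (Some f : F1poly n))%N.
Proof.
move=> fk; exists (mkexp (fun l => f (oi l) - (l == k))%N).
  congr Some; apply: exp_ext => l; rewrite mkexpE oi_eq.
  by case: eqVneq => [->|_]; lia.
rewrite !pdegE (bigD1 k) //= [in ltnRHS](bigD1 k) //= mkexpE eqxx.
rewrite -addSn; apply: leq_add; first by lia.
by apply: leq_sum => l _; rewrite mkexpE leq_subr.
Qed.

(** Induction on the degree, splitting off one variable at a time; degree 0 leaves the monomial 1.
    Hence the variables in a prime determine it. *)
Lemma prime_monomial (p : F1poly n -> Prop) (f : {i | (i < n)%N} -> nat) :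
  prime_ideal p -> p (Some f) <-> exists2 k, (0 < f (oi k))%N & p (F1var k).
Proof.
move=> pp; split; last first.
  by case=> k /F1var_dvd[h -> _] pk; apply: prime_mul.
have [m] := ubnP (pdeg (Some f : F1poly n)); elim: m f => // m IH f.
rewrite ltnS => le pf.
have [[k fk]|nf] := pselect (exists k, (0 < f (oi k))%N); last first.
  case: (prime1 pp); move: pf; congr p; congr Some; apply: exp_ext => k.
  by have [->//|h] := posnP (f (oi k)); case: nf; exists k.
have [h fE lt] := F1var_dvd fk; move: pf; rewrite fE => /(Defs.primeP pp)[pk|].
  by exists k.
move=> /IH[|l hl pl]; first exact: leq_trans lt le.
by exists l => //; move: fE => [->]; rewrite ltn_addl.
Qed.

Section Points.
Variables (g : grading (F1poly n)) (D : (F1poly n -> Prop) -> Prop).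

Definition nonvanishing (x : fr_pt D) : {set 'I_n} :=
  [set k | ~~ `[< fr_ideal x (F1var k) >]]%SET.

Lemma nonvanishingP (x : fr_pt D) k :
  reflect (~ fr_ideal x (F1var k)) (k \in nonvanishing x).
Proof. by rewrite inE; apply: asboolPn. Qed.

Lemma in_fr_ideal (x : fr_pt D) f :
  fr_ideal x (Some f) <-> exists2 k, (0 < f (oi k))%N & k \notin nonvanishing x.
Proof.
split=> [/(prime_monomial _ (fr_prime x))[k fk pk]|[k fk pk]].
  by exists k => //; apply/nonvanishingP.
apply/(prime_monomial _ (fr_prime x)); exists k => //.
by apply: contrapT => /nonvanishingP; rewrite (negbTE pk).
Qed.

Lemma notin_fr_ideal (x : fr_pt D) f :
  ~ fr_ideal x (Some f) <-> forall k, k \notin nonvanishing x -> f (oi k) = 0%N.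
Proof.
rewrite in_fr_ideal; split=> [h k kn|h [k fk /h]]; last by lia.
by apply/eqP; rewrite -leqn0 leqNgt; apply/negP => fk; apply: h; exists k.
Qed.

Lemma fr_ideal_None (x : fr_pt D) : fr_ideal x None.
Proof. exact: prime0 (fr_prime x). Qed.

Lemma nonvanishing_inj : injective nonvanishing.
Proof.
move=> x y e; apply: fr_pt_eq => -[f|]; last first.
  by split=> _; apply: fr_ideal_None.
by rewrite !in_fr_ideal e.
Qed.

Lemma nonvanishing_open k : fr_op [set x | k \in nonvanishing x].
Proof.
rewrite (_ : mkset _ = [set x | ~ fr_ideal x (F1var k)]); first exact: fr_op_D.
by apply/seteqP; split=> x /= /nonvanishingP.
Qed.

(** By cardinality the coordinates of x cannot form a subset of those of y unless x = y, so some
    coordinate vanishes at y and not at x. *)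
Lemma nonvanishing_sep (x y : fr_pt D) :
  x <> y -> (#|nonvanishing y| <= #|nonvanishing x|)%N ->
  exists V, [/\ fr_op V, V x & ~ V y].
Proof.
move=> ne le; have /subsetPn[k kx ky] : ~~ (nonvanishing x \subset nonvanishing y).
  apply/negP => s; apply: ne; apply: nonvanishing_inj.
  by apply/eqP; rewrite eqEcard s.
exists [set z | k \in nonvanishing z]; split=> //; first exact: nonvanishing_open.
exact/negP.
Qed.

Section Residue.
Variables (x : fr_pt D) (m : nat) (e : zidx m -> 'I_n).

(* The residue at x is the lattice of exponents at the coordinates e j. *)
Hypothesis e_inj : forall f s h t : {i | (i < n)%N} -> nat,
  fr_ok g x (Some f) (Some s) -> ~ fr_ideal x (Some f) ->
  fr_ok g x (Some h) (Some t) -> ~ fr_ideal x (Some h) ->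
  (forall j, f (oi (e j)) + t (oi (e j)) = h (oi (e j)) + s (oi (e j)))%N ->
  forall k, (f (oi k) + t (oi k) = h (oi k) + s (oi k))%N.
Hypothesis e_surj : forall v : zidx m -> int, exists f s,
  [/\ fr_ok g x (Some f) (Some s), ~ fr_ideal x (Some f) &
      forall j, ((f (oi (e j)))%:Z - (s (oi (e j)))%:Z = v j)%R].

(** The vector of exponents of a/s at the coordinates [e j], with numerators in the prime sent to 0.
    The branch [s = None] never arises from a fraction, as 0 lies in every prime. *)
Definition frac_exp (a s : F1poly n) : Z0 m :=
  if pselect (fr_ideal x a) then None else
  match a, s with
  | Some f, Some h => Some (fun j => (f (oi (e j)))%:Z - (h (oi (e j)))%:Z)%R
  | _, _ => None
  end.

Lemma frac_exp0 a s : fr_ideal x a -> frac_exp a s = 0.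
Proof. by rewrite /frac_exp; case: pselect. Qed.

Lemma frac_expN f s : ~ fr_ideal x (Some f) -> frac_exp (Some f) (Some s) =
  Some (fun j => (f (oi (e j)))%:Z - (s (oi (e j)))%:Z)%R.
Proof. by rewrite /frac_exp; case: pselect. Qed.

Lemma frac_exp_eq (z : fr_stalk g x) a s b t :
  is_frac z a s -> is_frac z b t -> frac_exp a s = frac_exp b t.
Proof.
move=> za zb; have [pa|na] := pselect (fr_ideal x a).
  by rewrite !frac_exp0 //; apply/(frac_not_unit zb)/(frac_not_unit za).
have nb : ~ fr_ideal x b by move=> /(frac_not_unit zb)/(frac_not_unit za).
have [ns _] := is_frac_ok za; have [nt _] := is_frac_ok zb.
have [_ [u nu]] := (is_fracE _ _ za).1 zb.
case: a s b t u na nb ns nt nu {za zb} => [f|] [s|] [h|] [t|] [w|] na nb ns nt nu;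
  try by have := fr_ideal_None x.
move=> /Some_fun E; rewrite !frac_expN //; congr Some.
apply/funext => j; have := E (oi (e j)); lia.
Qed.

Lemma residue_ex (z : fr_stalk g x) :
  exists w, forall a s, is_frac z a s -> w = frac_exp a s.
Proof.
have [a [s za]] := is_frac_ex z; exists (frac_exp a s) => b t.
exact: frac_exp_eq.
Qed.

Lemma residue_torus : exists f : fr_stalk g x -> Z0 m, is_residue f.
Proof.
have [f fE] := choice residue_ex; exists f.
have gw := Z0_gw0 m.
have funitE z a s : is_frac z a s -> is_funit (f z) <-> ~ fr_ideal x a.
  move=> za; rewrite (fE _ _ _ za); have [ns _] := is_frac_ok za.
  have [pa|na] := pselect (fr_ideal x a).
    by rewrite frac_exp0 //; split=> // /gw.1.
  split=> // _; apply: gw.2; case: a s na ns {za} => [h|] [s|] na ns;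
    try by have := fr_ideal_None x.
  by rewrite frac_expN.
have f0 z a s : is_frac z a s -> f z = 0 -> fr_ideal x a.
  by move=> za fz; apply: contrapT => /(funitE _ _ _ za); rewrite fz => /gw.1.
split.
- split=> [||y z].
  + rewrite (fE _ _ _ (is_frac_mk _)) frac_expN; last exact: prime1 (fr_prime x).
    by congr Some; apply/funext => j; rewrite subrr.
  + by rewrite (fE _ _ _ (is_frac_mk _)) frac_exp0 //; apply: fr_ideal_None.
  + have [a [s ya]] := is_frac_ex y; have [b [t zb]] := is_frac_ex z.
    rewrite (fE _ _ _ (is_fracM ya zb)) (fE _ _ _ ya) (fE _ _ _ zb).
    have px := fr_prime x.
    have [pa|na] := pselect (fr_ideal x a).
      by rewrite [frac_exp a s]frac_exp0 // fmul0 frac_exp0 //; exact: (prime_mul px).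
    have [pb|nb] := pselect (fr_ideal x b).
      by rewrite [frac_exp b t]frac_exp0 // fmulr0 frac_exp0 //; exact: (prime_mulr _ px).
    have nab := fr_idealM na nb.
    have [ns _] := is_frac_ok ya; have [nt _] := is_frac_ok zb.
    case: a s b t na nb ns nt nab {ya zb} => [h|] [s|] [k|] [t|] na nb ns nt nab;
      try by have := fr_ideal_None x.
    rewrite !frac_expN //; congr Some; apply/funext => j; lia.
- move=> z; have [a [s za]] := is_frac_ex z.
  by rewrite (funitE _ _ _ za) (frac_unit za).
- case=> [v|]; last first.
    exists 0; rewrite (fE _ _ _ (is_frac_mk _)) frac_exp0 //; exact: fr_ideal_None.
  have [h [s [ok nh E]]] := e_surj v; exists (mk_frac ok).
  rewrite (fE _ _ _ (is_frac_mk _)) frac_expN //; congr Some; exact/funext.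
- move=> y z; have [a [s ya]] := is_frac_ex y; have [b [t zb]] := is_frac_ex z.
  move=> E; have [fy0|fy] := pselect (f y = 0); [by right|left].
  have na : ~ fr_ideal x a.
    by move=> pa; apply: fy; rewrite (fE _ _ _ ya) frac_exp0.
  have nb : ~ fr_ideal x b.
    by move=> pb; apply: fy; rewrite E (fE _ _ _ zb) frac_exp0.
  have oka := is_frac_ok ya; have okb := is_frac_ok zb.
  have [ns _] := oka; have [nt _] := okb.
  apply: (is_frac_inj ya); apply/(is_fracE _ _ zb); split=> //.
  exists 1; first exact: prime1 (fr_prime x).
  move: E; rewrite (fE _ _ _ ya) (fE _ _ _ zb) !fmul1.
  case: a s b t na nb ns nt oka okb {ya zb} => [h|] [s|] [k|] [t|] na nb ns nt oka okb;
    try by have := fr_ideal_None x.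
  rewrite !frac_expN // => /Some_fun E; congr Some; apply: exp_ext => l.
  by apply: (e_inj okb nb oka na) => j; have := E j; lia.
Qed.

End Residue.
End Points.
End Exponents.

Lemma zidx_enum (T : finType) (A : {set T}) : exists e : zidx #|A| -> T,
  injective e /\ forall k, k \in A <-> exists j, e j = k.
Proof.
move Em : #|A| => m; elim: m A Em => [|m IH] A Em.
  exists (fun i : Empty_set => match i with end); split=> [[]|k].
  by rewrite (cards0_eq Em) inE; split=> // -[[]].
have /card_gt0P[a Aa] : (0 < #|A|)%N by rewrite Em.
have [|e [ie eE]] := IH (A :\ a)%SET.
  by move: Em; rewrite (cardsD1 a) Aa add1n => -[].
have nea j : e j <> a by move=> ea; have := (eE a).2 (ex_intro _ j ea); rewrite !inE eqxx.
exists (fun i => if i is Some j then e j else a); split.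
  by move=> [i|] [j|] //= => [/ie ->|/nea|/esym/nea].
move=> k; split=> [Ak|[[j|] <- //]]; last first.
  by have /setD1P[] := (eE (e j)).2 (ex_intro _ j erefl).
have [->|ka] := eqVneq k a; first by exists None.
by have [|j ej] := (eE k).1; [rewrite !inE ka | exists (Some j)].
Qed.

(** Supplies the exponents of a numerator and of a denominator whose quotient has prescribed integer
    exponents on A. *)
Lemma zidx_split (T : finType) (A : {set T}) m (e : zidx m -> T) :
    injective e -> (forall k, k \in A <-> exists j, e j = k) ->
  forall v : zidx m -> int, exists P N : T -> nat,
    (forall j, ((P (e j))%:Z - (N (e j))%:Z)%R = v j) /\
    forall k, k \notin A -> P k = 0%N /\ N k = 0%N.
Proof.
move=> ie eE v.
have ex k : exists w : nat * nat, (forall j, e j = k -> (w.1%:Z - w.2%:Z)%R = v j) /\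
    (k \notin A -> w = (0, 0)%N).
  have [/eE[j ej]|nk] := boolP (k \in A); last first.
    exists (0, 0)%N; split=> // j ej; case/negP: nk; apply/eE; by exists j.
  have [w hw] : exists w : nat * nat, (w.1%:Z - w.2%:Z)%R = v j.
    case: (v j) => k'; first by exists (k', 0)%N => /=; lia.
    by exists (0, k'.+1)%N => /=; lia.
  exists w; split=> // i ei; by rewrite hw; congr v; apply: ie; rewrite ei.
have [w hw] := choice ex; exists (fun k => (w k).1), (fun k => (w k).2); split.
  by move=> j; apply: (hw (e j)).1.
by move=> k /(hw k).2 ->.
Qed.

Section PointOfSet.
Variables (n : nat) (T : {set 'I_n}).

(** The prime generated by the variables outside T. *)
Definition set_ideal (a : F1poly n) : Prop :=
  if a is Some f then exists2 k, k \notin T & (0 < f (oi k))%N else True.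

Lemma set_ideal_prime : prime_ideal set_ideal.
Proof.
split=> //.
- by case=> [f|] [h|] //= [k kT fk]; exists k; rewrite ?ltn_addr.
- by case.
- case=> [f|] [h|] /=; try by [left|right].
  move=> [k kT]; rewrite addn_gt0 => /orP[fk|hk].
    by left; exists k.
  by right; exists k.
Qed.

Lemma set_ideal_var k : set_ideal (F1var k) <-> k \notin T.
Proof.
split=> [[l lT]|kT]; first by rewrite oi_eq lt0b => /eqP <-.
by exists k; rewrite ?oi_eq ?eqxx.
Qed.

Lemma nonvanishing_set_ideal (D : (F1poly n -> Prop) -> Prop) (h : D set_ideal) :
  nonvanishing (exist _ set_ideal (conj set_ideal_prime h) : fr_pt D) = T.
Proof.
apply/setP => k; apply/nonvanishingP/idP => /= [nk|kT].
  by apply/negPn/negP => /set_ideal_var.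
by move/set_ideal_var; rewrite kT.
Qed.

End PointOfSet.

(** Outside the prime at x lie exactly the monomials in the nonvanishing coordinates; with the
    trivial grading their quotients form the full lattice on that set. *)
Lemma Spec_F1poly_stratified n :
  @stratified (Spec (F1poly n)) {set 'I_n} (@nonvanishing n _) (fun T => #|T|).
Proof.
split; [exact: nonvanishing_inj| |exact: nonvanishing_sep].
move=> x; have [e [ie eE]] := zidx_enum (nonvanishing x).
apply: (@residue_torus _ _ _ x _ e) => [f s h t [ns _] nf [nt _] nh E k|v].
  have [/eE[j <-]|nk] := boolP (k \in nonvanishing x); first exact: E.
  by rewrite ((notin_fr_ideal _ _).1 nf) ?((notin_fr_ideal _ _).1 ns)
    ?((notin_fr_ideal _ _).1 nh) ?((notin_fr_ideal _ _).1 nt).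
have [P [N [PN out]]] := zidx_split ie eE v.
have nE (Q : 'I_n -> nat) : (forall k, k \notin nonvanishing x -> Q k = 0%N) ->
    ~ fr_ideal x (Some (mkexp Q)).
  by move=> hQ; apply/notin_fr_ideal => k /hQ; rewrite mkexpE.
exists (mkexp P), (mkexp N); split.
- by split; [apply: nE => k /out[]|right].
- by apply: nE => k /out[].
- by move=> j; rewrite !mkexpE.
Qed.

(** A prime of [Proj] misses some monomial of positive degree, and every variable occurring in that
    monomial is nonvanishing. *)
Lemma PP_nonempty n (x : PP n) : exists k, k \in nonvanishing x.
Proof.
apply: contrapT => h; have [[f|//] f0 nf] := (proj2_sig x).2.
move: f0; rewrite [(_ < _)%N](_ : _ = (0 < pdeg (Some f : F1poly n))%N) // pdegE.
rewrite big1 // => k _; apply/eqP; rewrite -leqn0 leqNgt; apply/negP => fk.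
apply: h; exists k; apply/nonvanishingP => pk; apply: nf.
by apply/(prime_monomial _ (fr_prime x)); exists k.
Qed.

Lemma PP_stratified n :
  @stratified (PP n) {set 'I_n} (@nonvanishing n _) (fun T => #|T|.-1).
Proof.
split; first exact: nonvanishing_inj; last first.
  move=> x y ne le; apply: nonvanishing_sep => //; move: le.
  (* Ranks are cardinals minus one in truncated subtraction, so they compare like the cardinals only
     because both sets are nonempty. *)
  have [k kx] := PP_nonempty x; have [l ly] := PP_nonempty y.
  have : (0 < #|nonvanishing x|)%N by apply/card_gt0P; exists k.
  lia.
move=> x; have [t0 t0x] := PP_nonempty x.
(* One nonvanishing coordinate t0 is left out: in a fraction of degree 0 its exponent is determined
   by the others. *)
have Em : #|nonvanishing x|.-1 = #|nonvanishing x :\ t0|%SET.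
  by rewrite (cardsD1 t0) t0x.
rewrite Em; have [e [ie eE]] := zidx_enum (nonvanishing x :\ t0)%SET.
have ok f s : fr_ok (pgrading n) x (Some f) (Some s) <->
    ~ fr_ideal x (Some s) /\ (\sum_k f (oi k) = \sum_k s (oi k))%N.
  by split=> [[ns [//|]]|[ns d]]; split=> //; right.
apply: (@residue_torus _ _ _ x _ e).
  move=> f s h t /ok[ns d1] nf /ok[nt d2] nh E.
  have E' k : k != t0 -> (f (oi k) + t (oi k) = h (oi k) + s (oi k))%N.
    move=> kt0; have [kx|nk] := boolP (k \in nonvanishing x).
      by have [|j <-] := (eE k).1; [apply/setD1P | exact: E].
    by rewrite ((notin_fr_ideal _ _).1 nf) ?((notin_fr_ideal _ _).1 ns)
      ?((notin_fr_ideal _ _).1 nh) ?((notin_fr_ideal _ _).1 nt).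
  move=> k; have [->{k}|] := eqVneq k t0; last exact: E'.
  (* Equality of total degrees turns agreement away from t0 into agreement at t0. *)
  have : (\sum_k (f (oi k) + t (oi k)) = \sum_k (h (oi k) + s (oi k)))%N.
    by rewrite !big_split /= d1 d2 addnC.
  rewrite (bigD1 t0) //= [in RHS](bigD1 t0) //=.
  by rewrite (eq_bigr (fun k => h (oi k) + s (oi k))%N) // => /addIn.
move=> v; have [P [N [PN out]]] := zidx_split ie eE v.
(* the exponents at t0 make the two degrees equal *)
pose ex (Q R : 'I_n -> nat) k := if k == t0 then (\sum_l R l)%N else Q k.
have exN (Q R : 'I_n -> nat) : (forall k, k \notin (nonvanishing x :\ t0)%SET ->
    Q k = 0%N) -> ~ fr_ideal x (Some (mkexp (ex Q R))).
  move=> hQ; apply/notin_fr_ideal => k nk; rewrite mkexpE /ex.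
  by case: eqVneq nk => [->|_ nk]; rewrite ?t0x // hQ // in_setD1 (negbTE nk) andbF.
have exD (Q R : 'I_n -> nat) : (forall k, k \notin (nonvanishing x :\ t0)%SET ->
    Q k = 0%N) -> (\sum_k mkexp (ex Q R) (oi k) = \sum_k R k + \sum_k Q k)%N.
  move=> hQ; rewrite (bigD1 t0) //= mkexpE {1}/ex eqxx; congr addn.
  rewrite [RHS](bigD1 t0) //= hQ ?in_setD1 ?eqxx //.
  by apply: eq_bigr => k /negbTE kt0; rewrite mkexpE /ex kt0.
have outP k h := (out k h).1; have outN k h := (out k h).2.
exists (mkexp (ex P N)), (mkexp (ex N P)); split.
- by apply/ok; split; [exact: exN | rewrite !exD // addnC].
- exact: exN.
- move=> j; have /setD1P[ejt0 _] := (eE (e j)).2 (ex_intro _ j erefl).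
  by rewrite !mkexpE /ex (negbTE ejt0).
Qed.

Lemma PP_point n (T : {set 'I_n}) : T != finset.set0 ->
  exists x : PP n, nonvanishing x = T.
Proof.
move=> /set0Pn[k kT].
have h : exists2 a, (0 < pgrading n a)%N & ~ set_ideal T a.
  exists (F1var k); last by rewrite set_ideal_var kT.
  by rewrite [pgrading n _]pdegE (bigD1 k) //= eqxx.
by eexists; apply: (@nonvanishing_set_ideal n T
  (fun p => exists2 a, (0 < pgrading n a)%N & ~ p a) h).
Qed.

(** * The binomial formula and the class of the affine line *)

Local Open Scope ring_scope.

Lemma sum_subsets (R : comPzRingType) (T : finType) (A : {set T}) (x : R) :
  \sum_(S : {set T} | S \subset A) x ^+ #|S| = (x + 1) ^+ #|A|.
Proof.
rewrite exprD1n (partition_big (fun S : {set T} => inord #|S| : 'I_#|A|.+1)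
  predT) //=.
apply: eq_bigr => i _.
have E (S : {set T}) : (S \subset A) && (inord #|S| == i) =
    (S \in [set S : {set T} | (S \subset A) & (#|S| == i)]).
  rewrite inE; have [SA|//] := boolP (S \subset A) => /=.
  by rewrite -val_eqE /= inordK // ltnS subset_leq_card.
rewrite (eq_bigl _ _ E) (eq_bigr (fun=> x ^+ i)) => [|S]; last first.
  by rewrite inE => /andP[_ /eqP ->].
by rewrite sumr_const cards_draws.
Qed.

Lemma LL_torus : LL = classK (Pt 1) + 1.
Proof.
rewrite /LL (classK_stratified (Y := A1) (Spec_F1poly_stratified 1)).
(* With the exponent 1 written as the cardinal of the full set, the binomial formula becomes a sum
   over all subsets, and every subset is a point of A^1. *)
have -> : classK (Pt 1) + 1 = (classK (Pt 1) + 1) ^+ #|[set: 'I_1]%SET|.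
  by rewrite cardsT card_ord.
rewrite -sum_subsets.
apply: eq_big => [S|S _]; last exact: Pt_exp.
rewrite finset.subsetT; apply/labelsP.
exists (exist _ (set_ideal S) (conj (set_ideal_prime S) I)) => //.
exact: nonvanishing_set_ideal.
Qed.

Local Close Scope F1_scope.
Local Close Scope classical_set_scope.

(** * Loose graphs *)

Section LooseGraph.
Variable G : looseGraph.
Implicit Types (v : lvert G) (e : ledge G) (w : bvert G) (S : {set bvert G}).

Definition nbrs v : {set bvert G} := [set w | badj (inl v) w]%SET.
Definition ends e : {set bvert G} := [set w | binc w e]%SET.
Definition centered v S : bool := (inl v \in S) && (S \subset inl v |: nbrs v).

Definition piece_set S : bool :=
  [exists v, centered v S] ||
  [exists e, [forall v, ~~ linc v e] && (S == ends e)].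

Lemma inl_nbrs v : inl v \notin nbrs v.
Proof. by rewrite inE /badj eqxx. Qed.

Lemma centeredP v S : reflect
  (inl v \in S /\ forall w, w != inl v -> ~~ badj (inl v) w -> w \notin S)
  (centered v S).
Proof.
apply: (iffP andP) => -[vS h]; split=> //.
  move=> w wv nadj; apply/negP => /(fintype.subsetP h).
  by rewrite in_setU1 (negbTE wv) inE (negbTE nadj).
apply/fintype.subsetP => w wS; rewrite in_setU1 inE.
by have [//|wv] := eqVneq w (inl v); apply: contraLR wS; apply: h.
Qed.

(** An edge with c vertices receives 2 - c new ends; the truncated subtraction in [new_end] is exact
    by [linc2]. *)
Lemma card_ends e : #|ends e| = 2%N.
Proof.
set c := #|[set v | linc v e]%SET|.
rewrite -sum1_card big_sumType /=.
have -> : (\sum_(v | inl v \in ends e) 1 = c)%N.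
  by rewrite /c -sum1_card; apply: eq_bigl => v; rewrite !inE.
have -> : (\sum_(x : {x | @new_end G x} | inr x \in ends e) 1 =
    \sum_(i < 2) (i < 2 - c))%N.
  rewrite (eq_bigl (fun x : {x | @new_end G x} => (val x).1 == e)); last first.
    by move=> x; rewrite inE.
  rewrite -(big_sub_cond (@new_end G) (fun x => x.1 == e) (fun=> 1%N)).
  rewrite big_mkcond /=.
  rewrite -(pair_bigA _ (fun a i => if (@new_end G (a, i)) && (a == e) then 1 else 0)%N) /=.
  rewrite (bigD1 e) //= [X in (_ + X)%N]big1 => [|a /negbTE ae]; last first.
    by apply: big1 => i _; rewrite ae andbF.
  rewrite addn0; apply: eq_bigr => i _; rewrite eqxx andbT /new_end /= -/c.
  by case: (_ < _)%N.
have := linc2 e; rewrite -/c !big_ord_recl big_ord0 /=.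
by case: c => [|[|[|]]].
Qed.

Lemma mem_enum_rank S w : (enum_rank w \in enum_rank @: S) = (w \in S).
Proof. by rewrite mem_imset //; apply: enum_rank_inj. Qed.

Lemma X0E (x : PG G) S w :
  nonvanishing x = enum_rank @: S -> X0 x w <-> w \notin S.
Proof.
move=> xS; rewrite -(mem_enum_rank S) -xS.
split=> [h|/nonvanishingP/contrapT //]; by apply/nonvanishingP => /(_ h).
Qed.

Lemma calF_piece_set (x : PG G) S :
  nonvanishing x = enum_rank @: S -> @calF G x <-> piece_set S.
Proof.
move=> xS; have X0S w := X0E w xS; split.
  move=> [[v [nv h]]|[e ne h]]; apply/orP; [left|right].
    apply/existsP; exists v; apply/centeredP; split.
      by apply: contrapT => /negP /X0S.
    by move=> w wv nadj; apply/X0S; apply: h.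
  apply/existsP; exists e; apply/andP; split; first exact/forallP.
  apply/eqP/setP => w; rewrite inE; apply/idP/idP => [wS|we].
    by apply/negPn/negP => /(h w).2 /X0S; rewrite wS.
  by apply/negPn/negP => /X0S /(h w).1; rewrite we.
case/orP => /existsP.
  move=> [v /centeredP[vS h]]; left; exists v; split; first by move/X0S; rewrite vS.
  by move=> w wv nadj; apply/X0S; apply: h.
move=> [e /andP[/forallP ne /eqP SE]]; right; exists e => // w.
by rewrite X0S SE inE.
Qed.

Lemma piece_set_neq0 S : piece_set S -> S != finset.set0.
Proof.
case/orP => /existsP[a] /andP[]; first by move=> aS _; apply/set0Pn; exists (inl a).
by move=> _ /eqP ->; rewrite -card_gt0 card_ends.
Qed.

Lemma graph_classE : graph_class G =
  \sum_(S : {set bvert G} | piece_set S) classK (Pt 1) ^+ #|S|.-1.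
Proof.
rewrite /graph_class (constr_class_labels (PP_stratified #|bvert G|)).
pose h (S : {set bvert G}) := (enum_rank @: S)%SET.
have hb : bijective h.
  exists (fun T : {set 'I_#|bvert G|} => [set enum_val k | k in T]%SET) => S;
    rewrite /h -imset_comp.
    by rewrite (eq_imset _ (@enum_rankK _)) imset_id.
  by rewrite (eq_imset _ (@enum_valK _)) imset_id.
rewrite (reindex h) /=; last exact: onW_bij.
apply: eq_big => [S|S _]; last by rewrite Pt_exp card_imset //; apply: enum_rank_inj.
apply/labelsP/idP => [[x xF xS]|SF]; first by apply/(calF_piece_set xS).
have [|x xS] := @PP_point _ (h S); last by exists x => //; apply/(calF_piece_set xS).
by rewrite imset_eq0 piece_set_neq0.
Qed.

Definition full_edges : {set ledge G} :=
  [set e | #|[set v | linc v e]%SET| == 2%N]%SET.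

Hypothesis treeG : loose_tree G.

Lemma simple_path_unique (v v' : lvert G) p q :
  simple_path v v' p -> simple_path v v' q -> p = q.
Proof. by move=> vp vq; have [r [_ u]] := treeG.2 v v'; rewrite -(u _ vp) (u _ vq). Qed.

(** Two parallel edges would give two simple paths from v to v'. *)
Lemma edge_unique (v v' : lvert G) e e' : v != v' ->
  linc v e -> linc v' e -> linc v e' -> linc v' e' -> e = e'.
Proof.
move=> ne ve v'e ve' v'e'.
have sp f : linc v f -> linc v' f -> simple_path v v' [:: inr f; inl v'].
  move=> vf v'f; split=> //=; first by rewrite vf v'f.
  by rewrite !inE /= andbT; apply: contra_neqN ne => /eqP[].
by have [] := simple_path_unique (sp _ ve v'e) (sp _ ve' v'e').
Qed.

Lemma edge_two (a b c : lvert G) e : linc a e -> linc b e -> linc c e ->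
  [|| a == b, b == c | a == c].
Proof.
move=> ae be ce; apply: contraT; rewrite !negb_or => /and3P[ab bc ac].
have := linc2 e; rewrite leqNgt; case/negP.
have : a |: (b |: [set c])%SET \subset [set v | linc v e]%SET.
  by apply/fintype.subsetP => v; rewrite !inE => /or3P[]/eqP->.
by move/subset_leq_card; rewrite !cardsU1 cards1 !inE negb_or ab bc ac.
Qed.

Lemma binc_unique v w e e' : w != inl v ->
  linc v e -> binc w e -> linc v e' -> binc w e' -> e = e'.
Proof.
case: w => [u|x] /= ne ve we ve' we'; last by rewrite -(eqP we) (eqP we').
apply: (@edge_unique v u) => //; by apply: contra_neq ne => ->.
Qed.

(** If w is an old vertex, the edge from v to v' and the detour through w are two simple paths,
    unless the detour uses a single edge, which would then have three vertices. If w is a new end,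
    its only edge contains both v and v', so it receives no new end. *)
Lemma no_triangle (v v' : lvert G) w : v != v' -> w != inl v -> w != inl v' ->
  badj (inl v) (inl v') -> badj (inl v) w -> badj (inl v') w -> False.
Proof.
move=> vv' wv wv' /andP[_ /existsP[e1 /andP[/= ve1 v'e1]]].
move=> /andP[_ /existsP[e2 /andP[/= ve2 we2]]].
move=> /andP[_ /existsP[e3 /andP[/= v'e3 we3]]].
case: w wv wv' we2 we3 => [u|x] /= uv uv' ue2 ue3.
  have {}uv : u != v by apply: contra_neq uv => ->.
  have {}uv' : u != v' by apply: contra_neq uv' => ->.
  have [e23|e23] := eqVneq e2 e3.
    subst e3; have := edge_two ve2 v'e3 ue2.
    by rewrite (negbTE vv') eq_sym (negbTE uv') eq_sym (negbTE uv).
  have p1 : simple_path v v' [:: inr e1; inl v'].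
    split=> //=; first by rewrite ve1 v'e1.
    by rewrite !inE /= andbT; apply: contra_neqN vv' => /eqP[].
  have p2 : simple_path v v' [:: inr e2; inl u; inr e3; inl v'].
    split=> //=; first by rewrite ve2 ue2 ue3 v'e3.
    rewrite !inE !negb_or /= !andbT !(inj_eq inl_inj) !(inj_eq inr_inj).
    by rewrite eq_sym uv vv' e23 uv'.
  by have := simple_path_unique p1 p2.
have := valP x; rewrite /new_end (eqP ue2).
suff : (1 < #|[set v | linc v e2]%SET|)%N by move=> h; lia.
by apply/card_gt1P; exists v, v'; rewrite !inE; split=> //; rewrite -(eqP ue2) (eqP ue3).
Qed.

(** Double count of the pairs (w, e) with e joining v to w != v: a neighbour lies on one such edge
    by [binc_unique], and an edge at v has one other end by [card_ends]. *)
Lemma card_nbrs v : #|nbrs v| = deg v.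
Proof.
pose E w := [set e | linc v e & binc w e]%SET.
have cE w : w != inl v -> #|E w| = (badj (inl v) w : nat).
  move=> wv; rewrite /badj eq_sym wv /=.
  have [/existsP[e /andP[/= ve we]]|/existsPn h] :=
    boolP [exists e, linc v e && binc w e].
    apply/eqP/cards1P; exists e; apply/setP => e'; rewrite !inE.
    apply/andP/eqP => [[ve' we']|-> //]; exact: binc_unique wv ve' we' ve we.
  by apply/eqP; rewrite cards_eq0; apply/eqP/setP => e; rewrite !inE; apply/negbTE.
have -> : #|nbrs v| = (\sum_(w | w != inl v) #|E w|)%N.
  rewrite (eq_bigr _ cE) -sum1_card big_mkcond [RHS]big_mkcond; apply: eq_bigr => w _.
  by rewrite inE /badj eq_sym; case: eqP; case: existsP.
rewrite /deg -sum1_card.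
under eq_bigr do rewrite -sum1_card big_mkcond.
rewrite exchange_big [RHS]big_mkcond; apply: eq_bigr => e _.
rewrite inE; have [ve|nve] := boolP (linc v e); last first.
  by apply: big1 => w _; rewrite inE (negbTE nve).
have : #|ends e :\ inl v|%SET = 1%N.
  by have := card_ends e; rewrite (cardsD1 (inl v)) inE /= ve => -[].
rewrite -sum1_card => E1; apply: etrans E1; rewrite -big_mkcondr; apply: eq_bigl => w.
by rewrite !inE ve.
Qed.

(** Removing v is a bijection onto the subsets of [nbrs v] that lowers the cardinal by one, which
    matches the exponent |S| - 1. *)
Lemma sum_centered (x : K0) v :
  \sum_(S | centered v S) x ^+ #|S|.-1 = (x + 1) ^+ deg v.
Proof.
rewrite -card_nbrs -sum_subsets.
rewrite (reindex_onto (fun S : {set bvert G} => inl v |: S)%SET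
  (fun S => S :\ inl v)%SET) /=; last by move=> S /andP[vS _]; rewrite finset.setD1K.
apply: eq_big => [S|S /andP[_ /eqP E]]; last first.
  by rewrite cardsU1; have := setD11 (inl v) (inl v |: S)%SET; rewrite E => ->.
rewrite /centered setU11 /=; apply/andP/idP => [[sub /eqP E]|sub].
  by rewrite -E; apply/fintype.subsetP => w /setD1P[wv /(fintype.subsetP sub)] /setU1P[/eqP|//];
    rewrite (negbTE wv).
split; first exact: finset.setUS.
by rewrite finset.setU1K //; apply: contra (inl_nbrs v); apply: (fintype.subsetP sub).
Qed.

Lemma ends_full e v v' : v != v' -> linc v e -> linc v' e ->
  ends e = [set inl v; inl v']%SET.
Proof.
move=> vv' ve v'e; apply/esym/eqP; rewrite eqEcard card_ends cards2.
rewrite (inj_eq inl_inj) vv' andbT.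
by apply/fintype.subsetP => w; rewrite !inE => /orP[]/eqP->.
Qed.

Lemma full_edgesP e :
  reflect (exists v v', [/\ v != v', linc v e & linc v' e]) (e \in full_edges).
Proof.
rewrite inE eqn_leq linc2 /=; apply: (iffP card_gt1P).
  by case=> v [v' []]; rewrite !inE => ve v'e ne; exists v, v'.
by case=> v [v' [ne ve v'e]]; exists v, v'; rewrite ?inE.
Qed.

Lemma centered_ends e v : e \in full_edges -> linc v e -> centered v (ends e).
Proof.
move=> /full_edgesP[a [b [ab ae be]]] ve; apply/andP; rewrite inE; split=> //.
apply/fintype.subsetP => w; rewrite !inE /badj => we.
rewrite [w == _]eq_sym; case: eqP => //= _; apply/existsP; exists e.
by rewrite /= ve we.
Qed.

(* The interior of an edge lies in the affine pieces of both of its vertices. *)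
Lemma card_centers S : #|[set v | centered v S]%SET| =
  ([exists v, centered v S] + (S \in [set ends e | e in full_edges]%SET))%N.
Proof.
have [/imsetP[e ef SE]|nS] := boolP (S \in _).
  have /full_edgesP[a [b [ab ae be]]] := ef.
  have -> : [set v | centered v S]%SET = [set v | linc v e]%SET.
    apply/setP => v; rewrite !inE SE; apply/idP/idP; last exact: centered_ends.
    by case/andP; rewrite inE.
  have -> : [exists v, centered v S].
    by apply/existsP; exists a; rewrite SE; apply: centered_ends.
  by move: ef; rewrite inE => /eqP.
rewrite addn0; have [/existsP[v vS]|/existsPn h] :=
    boolP [exists v, centered v S]; last first.
  by apply/eqP; rewrite cards_eq0; apply/eqP/setP => v; rewrite !inE; apply/negbTE.
apply/eqP/cards1P; exists v; apply/setP => v'; rewrite !inE.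
apply/idP/eqP => [v'S|-> //]; apply/eqP; apply: contraNT nS => v'v.
have /andP[vin vsub] := vS; have /andP[v'in v'sub] := v'S.
have adj : badj (inl v) (inl v').
  have := fintype.subsetP vsub _ v'in; rewrite in_setU1 (inj_eq inl_inj).
  by rewrite (negbTE v'v) inE.
have /andP[_ /existsP[e /andP[/= ve v'e]]] := adj.
rewrite eq_sym in v'v; apply/imsetP; exists e.
  by apply/full_edgesP; exists v, v'.
(* Two centers v and v' of S are adjacent, and any further element of S would form a triangle with
   them. *)
rewrite (ends_full v'v ve v'e); apply/eqP; rewrite finset.eqEsubset; apply/andP; split.
  apply/fintype.subsetP => w wS; rewrite !inE; apply: contraT.
  rewrite negb_or => /andP[wv wv'].
  have /setU1P[/eqP|] := fintype.subsetP vsub _ wS; first by rewrite (negbTE wv).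
  have /setU1P[/eqP|] := fintype.subsetP v'sub _ wS; first by rewrite (negbTE wv').
  by rewrite !inE => a1 a2; case: (no_triangle v'v wv wv' adj a2 a1).
by apply/fintype.subsetP => w; rewrite !inE => /orP[]/eqP->.
Qed.

(** Exchanging the sums counts each S once per center. By [card_centers] the excess is one for each
    set of ends of a full edge, of cardinal 2, which contributes x. *)
Lemma sum_centers (x : K0) : \sum_(v : lvert G) (x + 1) ^+ deg v =
  \sum_(S : {set bvert G} | [exists v, centered v S]) x ^+ #|S|.-1 + x *+ #|full_edges|.
Proof.
under eq_bigr do rewrite -sum_centered big_mkcond.
rewrite exchange_big /=.
have -> : x *+ #|full_edges| =
    \sum_(S in [set ends e | e in full_edges]%SET) x ^+ #|S|.-1.
  rewrite big_imset /=.
    by rewrite (eq_bigr (fun=> x)) ?sumr_const // => e _; rewrite card_ends.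
  move=> e e' /full_edgesP[v [v' [ne ve v'e]]] _ E.
  have ve' : inl v \in ends e' by rewrite -E inE.
  have v'e' : inl v' \in ends e' by rewrite -E inE.
  by rewrite !inE in ve' v'e'; apply: (edge_unique ne).
rewrite [X in _ = X + _]big_mkcond [X in _ = _ + X]big_mkcond -big_split /=.
apply: eq_bigr => S _; rewrite -big_mkcond sumr_const.
have -> : #|[pred v | centered v S]| = #|[set v | centered v S]%SET|.
  by apply: eq_card => v; rewrite !inE.
by rewrite card_centers mulrnDr; do 2!case: ifP => _ //=.
Qed.

End LooseGraph.

(** * Loose trees *)

Section Tree.
Variable G : looseGraph.
Hypothesis treeG : loose_tree G.
Implicit Types (a b r u v : lvert G) (e : ledge G).

(** Vertices and edges alternate along a path, so the path to v exhibits the parent u of v and the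
    edge between them. *)
Lemma simple_path_last r v p : simple_path r v p -> v != r ->
  exists q e u, [/\ p = q ++ [:: inr e; inl v], linc u e, linc v e, u != v &
    simple_path r u q].
Proof.
case: (lastP p) => [|p' z] [pp lp up] vr.
  by case: lp vr => ->; rewrite eqxx.
move: pp lp up; rewrite rcons_path last_rcons -rcons_cons rcons_uniq.
move=> /andP[pp lz] zv /andP[vn un]; subst z.
case: (lastP p') pp lz vn un => [//|q [u|e]]; rewrite last_rcons //.
rewrite rcons_path => /andP[pq lq] /= ve vn un.
case lE : (last (inl r) q) lq => [u|//] /= ue.
have uq : inl u \in inl r :: q by rewrite -lE mem_last.
exists q, e, u; split=> //; first by rewrite -!cats1 -catA.
  apply: contraNneq vn => <-; move: uq; rewrite !inE mem_rcons inE.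
  by case/orP=> ->; rewrite ?orbT.
split=> //; move: un; rewrite -[_ && _]/(uniq (rcons (inl r :: q) (inr e))) rcons_uniq.
by case/andP.
Qed.

Lemma simple_path_edge r v p e : simple_path r v p -> inr e \in p ->
  exists c d, [/\ c != d, linc c e, linc d e & inl c \in inl r :: p /\ inl d \in inl r :: p].
Proof.
move=> [pp lp up] ep; move: pp lp up; case/splitPr: ep => q1 q2.
rewrite cat_path last_cat /= => /and3P[_ l1 p2] lp up.
case cE : (last (inl r) q1) l1 => [c|//] /= ce.
have cq : inl c \in inl r :: q1 by rewrite -cE mem_last.
case: q2 p2 lp up => [|[d|//] q2] //= /andP[de _] _ /andP[rn un].
exists c, d; split=> //; last first.
  split; rewrite !(inE, mem_cat) ?eqxx ?orbT //.
  by move: cq; rewrite inE => /orP[]->; rewrite ?orbT.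
apply: contraTneq cq => ->; rewrite inE negb_or; apply/andP; split.
  by apply: contraNneq rn => <-; rewrite mem_cat !inE eqxx !orbT.
by move: un; rewrite cat_uniq /= !negb_or => /and3P[_ /and3P[_ dn _] _].
Qed.

(** If e were already on the path, both of its vertices would be on it by [simple_path_edge], and a
    is one of them. *)
Lemma simple_path_extend r a b p e : simple_path r b p -> a != b ->
  linc a e -> linc b e -> inl a \notin inl r :: p ->
  simple_path r a (p ++ [:: inr e; inl a]).
Proof.
move=> sp ab ae be an; have en : inr e \notin p.
  apply/negP => /(simple_path_edge sp)[c [d [cd ce de [cp dp]]]].
  have := edge_two ae ce de; rewrite (negbTE cd) /= => /orP[]/eqP aE.
    by rewrite aE cp in an.
  by rewrite aE dp in an.
have [pp lp up] := sp; split; rewrite ?cat_path ?last_cat //=.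
  by rewrite pp lp /= be ae.
move: up an => /=; rewrite cat_uniq !inE !mem_cat !inE !negb_or /= => /andP[-> ->] /andP[ar ->].
by rewrite en eq_sym ar.
Qed.

(** With root r, sending v != r to the last edge of the path from r to v is a bijection onto the
    full edges. *)
Lemma card_full_edges (r : lvert G) (e0 : ledge G) :
  (#|full_edges G|.+1 = #|{: lvert G}|)%N.
Proof.
have ex v : exists p, simple_path r v p by have [p []] := treeG.2 r v; exists p.
have [P hP] := choice ex.
(* The edge e0 only serves as the value at r, which choice requires. *)
have ex' v : exists e, v != r -> exists q u, [/\ P v = q ++ [:: inr e; inl v],
    linc u e, linc v e, u != v & simple_path r u q].
  have [->|vr] := eqVneq v r; first by exists e0.
  by have [q [e [u h]]] := simple_path_last (hP v) vr; exists e => _; exists q, u.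
have [pe peP] := choice ex'.
have -> : full_edges G = [set pe v | v in [set~ r]]%SET.
  apply/setP => e; apply/idP/imsetP => [/full_edgesP[a [b [ab ae be]]]|].
    have last_e c p : c != r -> P c = p ++ [:: inr e; inl c] -> e = pe c.
      move=> cr E; have [q [u [+ _ _ _ _]]] := peP c cr.
      have revE s (x y : lvert G + ledge G) : rev (s ++ [:: x; y]) = y :: x :: rev s.
        by rewrite rev_cat.
      by rewrite E => /(congr1 rev); rewrite !revE => -[].
    (* If b is not on the path to a, that path extended by e is the path to b. Otherwise a comes
       after b on it, so the initial segment up to b avoids a and extends by e to the path to a. *)
    have [bn|bn] := boolP (inl b \in inl r :: P a); last first.
      have br : b != r by apply: contraNneq bn => ->; rewrite inE eqxx.
      have h := simple_path_extend (hP a) (b := a) (a := b) _ be ae bn.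
      rewrite eq_sym in ab; have {}h := simple_path_unique treeG (hP b) (h ab).
      exists b; first by rewrite !inE.
      exact: last_e h.
    have sp := hP a; have [pp lp up] := sp.
    move: sp pp lp up; case/splitPl: bn => p1 p2 l1 sp.
    rewrite cat_path last_cat l1 => /andP[pp1 pp2] l2.
    rewrite -cat_cons cat_uniq => /and3P[u1 dis _].
    have s1 : simple_path r b p1 by [].
    have an : inl a \notin inl r :: p1.
      case: p2 l2 dis {sp pp2} => [|z p2] l2.
        by case: l2 ab => ->; rewrite eqxx.
      apply: contra => ain; apply/hasP; exists (inl a) => //.
      by rewrite -l2 /= mem_last.
    have ar : a != r by apply: contraNneq an => ->; rewrite inE eqxx.
    exists a; first by rewrite !inE.
    have h := simple_path_extend s1 ab ae be an.
    exact: last_e (simple_path_unique treeG (hP a) h).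
  move=> [v]; rewrite in_setC1 => vr ->; have [q [u [_ ue ve uv _]]] := peP v vr.
  by apply/full_edgesP; exists u, v.
rewrite card_in_imset.
  rewrite -cardsT (cardsD1 r [set: _]%SET) inE add1n; congr S.
  by apply: eq_card => v; rewrite !inE andbT.
move=> v v'; rewrite !inE => vr v'r pev.
have [q [u [E ue ve uv sq]]] := peP v vr.
have [q' [u' [E' ue' ve' uv' sq']]] := peP v' v'r.
apply/eqP; apply: contraT => vv'; rewrite -pev in ue' ve'.
have {ue}uE : u = v'.
  have := edge_two ue ve ve'; rewrite (negbTE uv) (negbTE vv') /=.
  by move=> /eqP.
have {ue'}uE' : u' = v.
  have := edge_two ue' ve' ve; rewrite (negbTE uv') eq_sym (negbTE vv') /=.
  by move=> /eqP.
subst u u'; rewrite (simple_path_unique treeG sq (hP v')) in E.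
rewrite (simple_path_unique treeG sq' (hP v)) in E'.
(* If v and v' had the same last edge, each would be the parent of the other, and each path would be
   longer than the other by two. *)
have := congr1 size E; have := congr1 size E'; rewrite !size_cat /=; lia.
Qed.

Lemma lconnected_incident (x y : lvert G + ledge G) :
  x != y -> exists z, lincident x z.
Proof.
move=> xy; have /connectP[[|z p] /= pp yE] := treeG.1.2 x y.
  by rewrite yE eqxx in xy.
by exists z; case/andP: pp.
Qed.

Lemma edge_has_vertex (r : lvert G) e : exists v, linc v e.
Proof.
by have [|[v|//] /= ve] := @lconnected_incident (inr e) (inl r); last by exists v.
Qed.

Lemma deg_gt0 (e0 : ledge G) v : (0 < deg v)%N.
Proof.
have [|[//|e] /= ve] := @lconnected_incident (inl v) (inr e0); first by [].
by apply/card_gt0P; exists e; rewrite inE.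
Qed.

(** Once there is a vertex, connectedness gives every edge a vertex, so only the affine pieces
    remain. *)
Lemma graph_class_tree (r : lvert G) (e0 : ledge G) : graph_class G =
  \sum_(v : lvert G) LL ^+ deg v - (LL - 1) *+ #|{: lvert G}|.-1.
Proof.
rewrite -(card_full_edges r e0) /= graph_classE.
have -> : LL - 1 = classK (Pt 1) by rewrite LL_torus addrK.
rewrite LL_torus (sum_centers treeG) addrK; apply: eq_bigl => S.
rewrite /piece_set; case: [exists v, _] => //=; apply/existsP => -[e /andP[]].
by have [v ve] := edge_has_vertex r e => /forallP/(_ v); rewrite ve.
Qed.

(** Without vertices nothing is incident to anything, so connectedness leaves a single edge, whose
    piece is G_m. *)
Lemma graph_class_edge (e0 : ledge G) :
  (lvert G -> False) -> graph_class G = LL - 1.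
Proof.
move=> V0; rewrite graph_classE LL_torus addrK (big_pred1 (ends e0)) => [|S].
  by rewrite card_ends expr1.
rewrite /piece_set pred1E; apply/orP/eqP => [[/existsP[v]|]|<-].
- by case: (V0 v).
- move=> /existsP[e /andP[_ /eqP ->]]; congr ends; apply/eqP; apply: contraT => ee0.
  have [|[v|//]] := @lconnected_incident (inr e0) (inr e); last by case: (V0 v).
  by rewrite (inj_eq inr_inj).
- by right; apply/existsP; exists e0; rewrite eqxx andbT; apply/forallP => v; case: (V0 v).
Qed.

End Tree.

(** The hypothesis [edgeG] excludes the graph with one vertex and no edge: its only piece is A^0, of
    class 1, whereas k = 0, E = 0 and I = -1 would give L - 1. *)
Theorem mainTheorem1 (G : looseGraph) (treeG : loose_tree G)
    (edgeG : (0 < #|ledge G|)%N)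
    (k : nat) (d n : 'I_k -> nat)
    (d_gt1 : forall i, (1 < d i)%N)
    (d_incr : forall i j : 'I_k, (i < j)%N -> (d i < d j)%N)
    (d_occ : forall m : nat, (1 < m)%N ->
       (exists v : lvert G, deg v = m) <-> (exists i, d i = m))
    (n_def : forall i, n i = #|[set v : lvert G | deg v == d i]%SET|)
    (I : int) (I_def : I = (\sum_(i < k) n i)%N%:Z - 1)
    (E : nat) (E_def : E = #|[set v : lvert G | deg v == 1%N]%SET|) :
  graph_class G =
    \sum_(i < k) (LL ^+ d i *+ n i) - LL *~ I + I%:~R + E%:R :> K0.
Proof.
have /card_gt0P[e0 _] := edgeG.
have d_inj : injective d.
  move=> i j dij; apply/eqP; apply: contraT; rewrite neq_ltn => /orP[]/d_incr.
    by rewrite dij ltnn.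
  by rewrite dij ltnn.
(* Groups the vertices by degree; degree 0 does not occur by [deg_gt0]. The target is general
   because the identity is used for classes and also for counting the vertices. *)
have split_deg (R : nmodType) (F : nat -> R) :
    \sum_(v : lvert G) F (deg v) = \sum_(i < k) F (d i) *+ n i + F 1%N *+ E.
  rewrite (bigID (fun v => deg v == 1%N)) /= addrC; congr (_ + _); last first.
    rewrite (eq_bigr (fun=> F 1%N)) => [|v /eqP -> //].
    by rewrite sumr_const E_def; congr (_ *+ _); apply: eq_card => v; rewrite !inE.
  under [RHS]eq_bigr => i _.
    rewrite n_def -sumr_const; under eq_bigl do rewrite inE.
    under eq_bigr => v /eqP <- do over. over.
  rewrite (exchange_big_dep (fun v => deg v != 1%N)) /=; last first.
    by move=> i v _ /eqP ->; rewrite neq_ltn d_gt1 orbT.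
  apply: eq_bigr => v v1.
  have v_gt1 : (1 < deg v)%N by rewrite ltn_neqAle eq_sym v1 (deg_gt0 treeG e0).
  have [i di] := (d_occ _ v_gt1).1 (ex_intro _ v erefl).
  rewrite (big_pred1 i) // => j; rewrite pred1E -di.
  by rewrite eq_sym (inj_eq d_inj).
have [[r _]|V0] := pselect (exists r : lvert G, True).
  rewrite (graph_class_tree treeG r e0).
  rewrite (split_deg _ (fun m => LL ^+ m)) expr1.
  have cV : #|{: lvert G}| = (\sum_(i < k) n i + E)%N.
    rewrite -sum1_card (split_deg _ (fun=> 1%N)).
    by congr (_ + _)%N; [apply: eq_bigr => i _ |]; rewrite natn.
  have V1 : (0 < #|{: lvert G}|)%N by apply/card_gt0P; exists r.
  (* The number of full edges is I + E, so subtracting (L - 1)(I + E) cancels the terms E * L from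
     the vertices of degree 1 and leaves -I * L + I + E. *)
  have IE : (#|{: lvert G}|.-1)%:Z = I + E%:Z by rewrite I_def; lia.
  have -> : (LL - 1) *+ #|{: lvert G}|.-1 = LL *~ I + LL *+ E - I%:~R - E%:R.
    by rewrite pmulrn IE mulrzDr mulrzBl mulrzBl -!pmulrn; ring.
  ring.
have V0' : lvert G -> False by move=> v; apply: V0; exists v.
(* Without vertices no degree occurs, so k = 0, E = 0 and I = -1, and the formula reads L - 1. *)
have k0 (i : 'I_k) : False.
  by have [v _] := (d_occ (d i) (d_gt1 i)).2 (ex_intro _ i erefl); apply: V0' v.
rewrite (graph_class_edge treeG e0 V0').
have sum0 (R : nmodType) (F : 'I_k -> R) : \sum_i F i = 0.
  by apply: big1 => i; case: (k0 i).
have -> : E = 0%N.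
  by rewrite E_def; apply/eqP; rewrite cards_eq0; apply/eqP/setP => v; case: (V0' v).
have -> : I = -1 by rewrite I_def sum0.
by rewrite sum0 !mulrN1z sub0r opprK addr0.
Qed.
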